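(* Let $\beta\in[0,1)$ and let $f_\beta(x)=\sum_{i=0}^\infty c_i x^i$ be the unique analytic solution with $f_\beta(0)=1$ of $$\int_0^\infty \frac{f_\beta(sx)}{f_\beta(x)}\,dx=\frac{1}{1-s}-\beta\qquad\text{for all } s\in[0,1).$$ Then the limit $$\omega(\beta)=\lim_{x\to\infty}\frac{\log f_\beta(x)-x}{\log x}$$ exists (and is finite).
   Context: Existence and uniqueness of such an $f_\beta$ (with $f_\beta(0)=1$) is known; $f_\beta$ is the function encoding the $(\beta,1)$-balanced embedding of the complex plane with divisor the origin into a projective Hilbert space. *)

(* Defs.v *)
From Stdlib Require Import Reals.
From Coquelicot Require Import Coquelicot.
Open Scope R_scope.

Definition series_fun (c : nat -> R) (x : R) : R := PSeries c x.

Definition balanced_eq (beta : R) (f : R -> R) : Prop :=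
  forall s : R, 0 <= s < 1 ->
    is_RInt_gen (fun x => f (s * x) / f x) (at_point 0) (Rbar_locally p_infty)
      (1 / (1 - s) - beta).

(* Main.v *)
(** The limit is [beta]; in fact [ln f x - x - beta * ln x] stays bounded.

    Expanding the equation in powers of [s] says that the moments of [dx / f x] are
    [m k = mass k / c k], where [mass 0 = 1 - beta] and [mass k = 1] for [k > 0].  The
    expansion is legitimate after one integration in [s]: it replaces [f] by its
    primitive [P], which is increasing, and the integrability of [P (x / 2) / (x f x)]
    with the Cauchy-Schwarz inequality gives [P (4 y) >= y P y], hence all the decay
    that is needed.  In particular all the coefficients are positive.

    So [c k x ^ k / f x] is a coupling of the Lebesgue measure on the half-line with the
    counting measure (up to the missing mass [beta] at [k = 0]).  Comparing with bounded
    densities gives [ln f x = x + o(x)], and then the conditional mean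
    [N x = x f' x / f x] of the index given [x] satisfies [N x = x + o(x)], because it is
    increasing.

    Since [N] has integral [k + 1] against the density of index [k], the function [N x - x]
    is harmonic, up to a source at [k = 0], for the chain that goes from [x] to an index
    [k] and from [k - 1] to a new point.  As it is [o(x)] and [x] is harmonic too, the
    maximum principle gives [0 <= N x - x <= 1].

    Finally [h x = ln f x - x] has [0 <= h' x <= 1 / x]; writing the equation at
    [s = 1 - 1 / t] with [x = t u] compares the averages
    [ell t = int exp (- u) h (t u) du] at [t] and [t - 1]:
    [ell t - ell (t - 1) = beta / t + O (1 / t ^ 2)]. *)
Require Import Defs.
From Stdlib Require Import Reals.
From Stdlib Require Import Lra Lia Psatz.
From Coquelicot Require Import Coquelicot.
Open Scope R_scope.

(** * Improper integrals and entire series *)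

(** Equalities over the carrier of a normed module are restated over [R], so that [ring] applies. *)
Ltac eqR := match goal with |- ?a = ?b => change (@eq R a b) end.

Lemma ln_le_sub (x : R) : 0 < x -> ln x <= x - 1.
Proof.
  intros Hx. rewrite <- (ln_exp (x - 1)). apply ln_le; auto.
  assert (K := exp_ineq1_le (x - 1)). lra.
Qed.

Definition cont0 (g : R -> R) : Prop := forall x : R, 0 <= x -> continuous g x.

(** [RInt] is total, so this limit says nothing about integrability on bounded intervals; that comes
    separately, from [cont0]. *)
Definition int_to (g : R -> R) (l : R) : Prop :=
  is_lim (fun B => RInt g 0 B) p_infty l.

Lemma cont0_ex_derive (g : R -> R) :
  (forall x, 0 <= x -> ex_derive g x) -> cont0 g.
Proof.
  intros H x Hx. apply (ex_derive_continuous (K := R_AbsRing) (V := R_NormedModule)).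
  now apply H.
Qed.

Lemma cont0_plus (f g : R -> R) :
  cont0 f -> cont0 g -> cont0 (fun x => f x + g x).
Proof.
  intros Hf Hg x Hx.
  apply (continuous_plus (K := R_AbsRing) (V := R_NormedModule)); auto.
Qed.

Lemma cont0_mult (f g : R -> R) :
  cont0 f -> cont0 g -> cont0 (fun x => f x * g x).
Proof. intros Hf Hg x Hx. apply (continuous_mult (K := R_AbsRing)); auto. Qed.

Lemma cont0_const (k : R) : cont0 (fun _ => k).
Proof. intros x Hx. apply continuous_const. Qed.

Lemma cont0_ex_RInt (g : R -> R) (a b : R) :
  cont0 g -> 0 <= a -> 0 <= b -> ex_RInt g a b.
Proof.
  intros Hg Ha Hb. apply (ex_RInt_continuous (V := R_CompleteNormedModule)).
  intros z [Hz _]. apply Hg.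
  apply Rle_trans with (2 := Hz). now apply Rmin_glb.
Qed.

Lemma RInt_plus0 (f g : R -> R) (a b : R) :
  cont0 f -> cont0 g -> 0 <= a -> 0 <= b ->
  RInt (fun x => f x + g x) a b = RInt f a b + RInt g a b.
Proof.
  intros Hf Hg Ha Hb.
  apply (RInt_plus (V := R_CompleteNormedModule)); now apply cont0_ex_RInt.
Qed.

Lemma RInt_scal0 (f : R -> R) (k a b : R) :
  cont0 f -> 0 <= a -> 0 <= b ->
  RInt (fun x => k * f x) a b = k * RInt f a b.
Proof.
  intros Hf Ha Hb.
  apply (RInt_scal (V := R_CompleteNormedModule)); now apply cont0_ex_RInt.
Qed.

Lemma RInt_le0 (f g : R -> R) (a b : R) :
  cont0 f -> cont0 g -> 0 <= a <= b -> (forall x, a < x < b -> f x <= g x) ->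
  RInt f a b <= RInt g a b.
Proof. intros Hf Hg Hab H. apply RInt_le; try apply cont0_ex_RInt; auto; lra. Qed.

Lemma RInt_ge00 (f : R -> R) (a b : R) :
  cont0 f -> 0 <= a <= b -> (forall x, a < x < b -> 0 <= f x) -> 0 <= RInt f a b.
Proof. intros Hf Hab H. apply RInt_ge_0; try apply cont0_ex_RInt; auto; lra. Qed.

Lemma RInt_Chasles0 (f : R -> R) (a b c : R) :
  cont0 f -> 0 <= a -> 0 <= b -> 0 <= c ->
  RInt f a b + RInt f b c = RInt f a c.
Proof.
  intros Hf Ha Hb Hc.
  apply (RInt_Chasles (V := R_CompleteNormedModule)); now apply cont0_ex_RInt.
Qed.

Lemma RInt_primitive (F g : R -> R) (a b : R) :
  (forall x, Rmin a b <= x <= Rmax a b -> is_derive F x (g x)) ->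
  (forall x, Rmin a b <= x <= Rmax a b -> continuous g x) ->
  RInt g a b = F b - F a.
Proof.
  intros HF Hg. apply (is_RInt_unique (V := R_CompleteNormedModule)).
  now apply (is_RInt_derive (V := R_CompleteNormedModule)).
Qed.

Lemma RInt_const_R (k a b : R) : RInt (fun _ => k) a b = (b - a) * k.
Proof. exact (RInt_const (V := R_CompleteNormedModule) a b k). Qed.

Lemma int_to_ext (f g : R -> R) (l : R) :
  (forall x, 0 < x -> f x = g x) -> int_to f l -> int_to g l.
Proof.
  intros H. apply is_lim_ext_loc. exists 0. intros B HB.
  apply (RInt_ext (V := R_CompleteNormedModule)). intros x.
  rewrite Rmin_left, Rmax_right by lra. intros Hx. apply H. lra.
Qed.

Lemma int_to_plus (f g : R -> R) (lf lg : R) :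
  cont0 f -> cont0 g -> int_to f lf -> int_to g lg ->
  int_to (fun x => f x + g x) (lf + lg).
Proof.
  intros Cf Cg Hf Hg. unfold int_to.
  apply (is_lim_ext_loc (fun B => RInt f 0 B + RInt g 0 B)).
  - exists 0. intros B HB. symmetry. apply RInt_plus0; auto; lra.
  - now apply is_lim_plus'.
Qed.

Lemma int_to_scal (f : R -> R) (k l : R) :
  cont0 f -> int_to f l -> int_to (fun x => k * f x) (k * l).
Proof.
  intros Cf Hf. unfold int_to.
  apply (is_lim_ext_loc (fun B => k * RInt f 0 B)).
  - exists 0. intros B HB. symmetry. apply RInt_scal0; auto; lra.
  - exact (is_lim_scal_l _ k _ _ Hf).
Qed.

Lemma int_to_lin (f g : R -> R) (k lf lg : R) :
  cont0 f -> cont0 g -> int_to f lf -> int_to g lg ->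
  int_to (fun x => f x + k * g x) (lf + k * lg).
Proof.
  intros Cf Cg Hf Hg. apply int_to_plus; auto.
  - apply cont0_mult; auto. apply cont0_const.
  - now apply int_to_scal.
Qed.

Lemma is_lim_R_le (F G : R -> R) (B0 lF lG : R) :
  (forall B, B0 < B -> F B <= G B) ->
  is_lim F p_infty lF -> is_lim G p_infty lG -> lF <= lG.
Proof.
  intros H HF HG. refine (is_lim_le_loc F G p_infty lF lG _ HF HG).
  now exists B0.
Qed.

Lemma is_lim_R_ub (F : R -> R) (B0 l M : R) :
  (forall B, B0 < B -> F B <= M) -> is_lim F p_infty l -> l <= M.
Proof.
  intros H HF. apply (is_lim_R_le F (fun _ => M) B0 l M H HF). apply is_lim_const.
Qed.

Lemma is_lim_R_lb (F : R -> R) (B0 l M : R) :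
  (forall B, B0 < B -> M <= F B) -> is_lim F p_infty l -> M <= l.
Proof.
  intros H HF. apply (is_lim_R_le (fun _ => M) F B0 M l H); auto. apply is_lim_const.
Qed.

Lemma is_lim_R_event (F : R -> R) (l e : R) :
  is_lim F p_infty l -> 0 < e -> exists B0, forall B, B0 < B -> Rabs (F B - l) < e.
Proof.
  intros H He. apply is_lim_spec in H. destruct (H (mkposreal e He)) as [B0 HB].
  exists B0. exact HB.
Qed.

Lemma int_to_le (f g : R -> R) (lf lg : R) :
  cont0 f -> cont0 g -> (forall x, 0 <= x -> f x <= g x) ->
  int_to f lf -> int_to g lg -> lf <= lg.
Proof.
  intros Cf Cg H. apply is_lim_R_le with (B0 := 0). intros B HB.
  apply RInt_le0; auto; try lra. intros x Hx. apply H. lra.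
Qed.

Lemma RInt_incr0 (g : R -> R) (B B' : R) :
  cont0 g -> (forall x, 0 <= x -> 0 <= g x) -> 0 <= B <= B' ->
  RInt g 0 B <= RInt g 0 B'.
Proof.
  intros Cg Pg HB. rewrite <- (RInt_Chasles0 g 0 B B') by (auto; lra).
  assert (0 <= RInt g B B'); try lra.
  apply RInt_ge00; auto. intros x Hx; apply Pg; lra.
Qed.

Lemma int_to_ub (g : R -> R) (l B : R) :
  cont0 g -> (forall x, 0 <= x -> 0 <= g x) -> int_to g l -> 0 <= B ->
  RInt g 0 B <= l.
Proof.
  intros Cg Pg Hg HB. apply (is_lim_R_lb (fun B => RInt g 0 B) B); auto.
  intros B' HB'. apply RInt_incr0; auto; lra.
Qed.

(** The integrals up to [B] increase with [B], so they converge to their supremum. *)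
Lemma int_to_bounded (g : R -> R) (M : R) :
  cont0 g -> (forall x, 0 <= x -> 0 <= g x) ->
  (forall B, 0 <= B -> RInt g 0 B <= M) -> exists l, int_to g l.
Proof.
  intros Cg Pg HM.
  destruct (completeness (fun y => exists B, 0 <= B /\ y = RInt g 0 B)) as [l [Hu Hl]].
  - exists M. intros y [B [HB ->]]. auto.
  - exists (RInt g 0 0), 0. split; auto; lra.
  - exists l. apply is_lim_spec. intros eps.
    destruct (Classical_Prop.classic
                (exists B, 0 <= B /\ l - eps < RInt g 0 B)) as [[B [HB Hlt]]|Hn].
    + exists B. intros B' HB'.
      assert (RInt g 0 B <= RInt g 0 B') by (apply RInt_incr0; auto; lra).
      assert (RInt g 0 B' <= l) by (apply Hu; exists B'; split; auto; lra).
      apply Rabs_def1; lra.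
    + exfalso. assert (l <= l - eps).
      { apply Hl. intros y [B [HB ->]]. apply Rnot_lt_le. intros Hc.
        apply Hn. now exists B. }
      assert (0 < eps) by apply cond_pos. lra.
Qed.

(** The first half keeps integrability on bounded intervals: it serves to show that the denominator
    [f] does not vanish, before continuity of the quotient is available. *)
Lemma is_RInt_gen_int_to (g : R -> R) (l : R) :
  is_RInt_gen g (at_point 0) (Rbar_locally p_infty) l ->
  (exists B0, forall B, B0 < B -> ex_RInt g 0 B) /\ int_to g l.
Proof.
  intros H.
  assert (K : forall P : R -> Prop, locally l P ->
    exists B0, forall B, B0 < B -> exists y, is_RInt g 0 B y /\ P y).
  { intros P HP. destruct (H P HP) as [Q R0 HQ [B0 HR] HQR].
    exists B0. intros B HB. apply (HQR 0 B); auto. }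
  split.
  - destruct (K (fun _ => True)) as [B0 HB0].
    + apply filter_true.
    + exists B0. intros B HB. destruct (HB0 B HB) as [y [Hy _]]. now exists y.
  - intros P HP. destruct (K P HP) as [B0 HB0]. exists B0. intros B HB.
    destruct (HB0 B HB) as [y [Hy Py]].
    now rewrite (is_RInt_unique (V := R_CompleteNormedModule) g 0 B y Hy).
Qed.

(** * Entire power series *)

Definition entire (a : nat -> R) : Prop := CV_radius a = p_infty.

Lemma entire_lt (a : nat -> R) (x : R) :
  entire a -> Rbar_lt (Finite (Rabs x)) (CV_radius a).
Proof. intros H. rewrite H. exact I. Qed.

Lemma entire_ex (a : nat -> R) (x : R) : entire a -> ex_pseries a x.
Proof. intros H. apply CV_radius_inside. now apply entire_lt. Qed.

Lemma ex_pseries_series (a : nat -> R) (x : R) :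
  ex_pseries a x -> ex_series (fun n => a n * x ^ n).
Proof. intros H. now apply ex_pseries_R. Qed.

(** A finite radius [r] is absurd: the terms of the series would not tend to 0 at [r + 1]. *)
Lemma entire_intro (a : nat -> R) :
  (forall x : R, 0 <= x -> ex_pseries a x) -> entire a.
Proof.
  intros H. unfold entire. destruct (CV_radius a) as [r| |] eqn:E; auto.
  - exfalso.
    assert (Hr : 0 <= r).
    { assert (K := CV_radius_ge_0 a). now rewrite E in K. }
    assert (L := CV_disk_outside a (r + 1)).
    apply L.
    + rewrite E. simpl. rewrite Rabs_pos_eq; lra.
    + apply ex_series_lim_0, ex_pseries_series, H. lra.
  - assert (K := CV_radius_ge_0 a). now rewrite E in K.
Qed.

Lemma entire_derive (a : nat -> R) : entire a -> entire (PS_derive a).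
Proof. unfold entire. now rewrite CV_radius_derive. Qed.

Lemma is_derive_entire (a : nat -> R) (x : R) :
  entire a -> is_derive (PSeries a) x (PSeries (PS_derive a) x).
Proof. intros H. apply is_derive_PSeries. now apply entire_lt. Qed.

Lemma ex_derive_entire (a : nat -> R) (x : R) : entire a -> ex_derive (PSeries a) x.
Proof. intros H. eexists. now apply is_derive_entire. Qed.

Lemma Derive_entire (a : nat -> R) (x : R) :
  entire a -> Derive (PSeries a) x = PSeries (PS_derive a) x.
Proof. intros H. apply is_derive_unique. now apply is_derive_entire. Qed.

Lemma continuity_entire (a : nat -> R) (x : R) : entire a -> continuity_pt (PSeries a) x.
Proof. intros H. apply PSeries_continuity. now apply entire_lt. Qed.

(** The Euler operator, [x] times the derivative, on coefficients. *)
Definition euler (a : nat -> R) (n : nat) : R := INR n * a n.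

Lemma euler_incr (a : nat -> R) (n : nat) : PS_incr_1 (PS_derive a) n = euler a n.
Proof.
  destruct n as [|n]; unfold euler.
  - change (0 = INR 0 * a 0%nat). simpl. ring.
  - reflexivity.
Qed.

Lemma PSeries_euler (a : nat -> R) (x : R) :
  PSeries (euler a) x = x * PSeries (PS_derive a) x.
Proof.
  rewrite <- PSeries_incr_1. apply PSeries_ext. intros n. now rewrite euler_incr.
Qed.

Lemma entire_euler (a : nat -> R) : entire a -> entire (euler a).
Proof.
  intros H. unfold entire. rewrite <- (CV_radius_ext _ _ (euler_incr a)).
  rewrite CV_radius_incr_1. now apply entire_derive.
Qed.

Lemma PSeries_le (a b : nat -> R) (x : R) :
  0 <= x -> entire a -> entire b -> (forall n, a n <= b n) ->
  PSeries a x <= PSeries b x.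
Proof.
  intros Hx Ha Hb H.
  assert (P : 0 <= PSeries (PS_minus b a) x).
  { rewrite <- (PSeries_const_0 x). unfold PSeries. apply Series_le.
    - intros n. split; [lra|]. apply Rmult_le_compat_r.
      + now apply pow_le.
      + specialize (H n). change (0 <= b n + - a n). lra.
    - apply ex_pseries_series. apply ex_pseries_minus; now apply entire_ex. }
  rewrite PSeries_minus in P by now apply entire_ex. lra.
Qed.

Lemma entire_lin (a b : nat -> R) (k : R) :
  entire a -> entire b -> entire (fun n => a n + k * b n).
Proof.
  intros Ha Hb. apply entire_intro. intros x _.
  apply (ex_pseries_plus a (PS_scal k b)); [now apply entire_ex|].
  apply (ex_pseries_scal (K := R_AbsRing) (V := R_NormedModule)).
  - apply Rmult_comm.
  - now apply entire_ex.
Qed.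

Lemma PSeries_lin (a b : nat -> R) (k x : R) :
  entire a -> entire b ->
  PSeries (fun n => a n + k * b n) x = PSeries a x + k * PSeries b x.
Proof.
  intros Ha Hb. rewrite <- PSeries_scal.
  apply (PSeries_plus a (PS_scal k b)); [now apply entire_ex|].
  apply (ex_pseries_scal (K := R_AbsRing) (V := R_NormedModule)).
  - apply Rmult_comm.
  - now apply entire_ex.
Qed.

Lemma entire_0 : entire (fun _ => 0).
Proof. exact CV_radius_const_0. Qed.

Lemma PSeries_nonneg (a : nat -> R) (x : R) :
  0 <= x -> entire a -> (forall n, 0 <= a n) -> 0 <= PSeries a x.
Proof.
  intros Hx Ha H. rewrite <- (PSeries_const_0 x). apply PSeries_le; auto. apply entire_0.
Qed.

Lemma entire_decr_n (a : nat -> R) (n : nat) : entire a -> entire (PS_decr_n a n).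
Proof.
  intros Ha. induction n as [|n IH].
  - unfold entire. now rewrite (CV_radius_ext _ a) by reflexivity.
  - unfold entire. rewrite <- IH, <- (CV_radius_decr_1 (PS_decr_n a n)).
    apply CV_radius_ext. intros i. unfold PS_decr_n, PS_decr_1. f_equal. lia.
Qed.

(** The tail is [x ^ S n] times a series with nonnegative coefficients. The coefficients up to [n]
    may have any sign. *)
Lemma partial_sum_le (a : nat -> R) (n : nat) (x : R) :
  0 <= x -> entire a -> (forall k, (n < k)%nat -> 0 <= a k) ->
  sum_f_R0 (fun k => a k * x ^ k) n <= PSeries a x.
Proof.
  intros Hx Ha H. rewrite (PSeries_decr_n a n) by now apply entire_ex.
  assert (0 <= x ^ S n * PSeries (PS_decr_n a (S n)) x); [|lra].
  apply Rmult_le_pos; [now apply pow_le|]. apply PSeries_nonneg; auto.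
  - now apply entire_decr_n.
  - intros k. apply H. lia.
Qed.

(** * Calculus lemmas and elementary inequalities *)

Lemma is_derive_RInt0 (g : R -> R) (x : R) :
  cont0 g -> 0 < x -> is_derive (fun B => RInt g 0 B) x (g x).
Proof.
  intros Cg Hx. apply (is_derive_RInt (V := R_NormedModule) g _ 0); [|apply Cg; lra].
  exists (mkposreal x Hx). intros y Hy.
  apply (RInt_correct (V := R_CompleteNormedModule)). apply cont0_ex_RInt; auto; [lra|].
  change (Rabs (y - x) < x) in Hy. apply Rabs_def2 in Hy. lra.
Qed.

Lemma derive_nonneg_incr (g dg : R -> R) (a b : R) :
  a <= b -> (forall x, a <= x <= b -> is_derive g x (dg x)) ->
  (forall x, a <= x <= b -> 0 <= dg x) -> g a <= g b.
Proof.
  intros Hab Hd Hp.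
  destruct (MVT_gen g a b dg) as [xi [Hxi H]]; rewrite Rmin_left, Rmax_right in *; auto.
  - intros x Hx. apply Hd. lra.
  - intros x Hx. apply derivable_continuous_pt. eexists.
    apply is_derive_Reals. now apply Hd.
  - specialize (Hp xi Hxi). nra.
Qed.

(** Abel summation as an induction: replacing the weight [w n] by the smaller [w (S n)] in front of
    a nonnegative partial sum only lowers the left side. *)
Lemma weighted_sum_nonneg (d w : nat -> R) (n : nat) :
  (forall k, 0 <= w (S k) <= w k) -> (forall k, 0 <= sum_f_R0 d k) ->
  w n * sum_f_R0 d n <= sum_f_R0 (fun k => d k * w k) n.
Proof.
  intros Hw Hd. induction n as [|n IH]; simpl; [lra|].
  specialize (Hw n). specialize (Hd n). nra.
Qed.

(* Abel summation applied to [ln rho - ln r >= (rho - r) / rho]. *)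
Lemma sum_ln_le (rho r : nat -> R) (n : nat) :
  (forall k, 0 < r k) -> (forall k, 0 < rho k <= rho (S k)) ->
  (forall k, sum_f_R0 r k <= sum_f_R0 rho k) ->
  sum_f_R0 (fun k => ln (r k)) n <= sum_f_R0 (fun k => ln (rho k)) n.
Proof.
  intros Hr Hrho H.
  assert (Hw : forall k, 0 <= / rho (S k) <= / rho k).
  { intros k. destruct (Hrho k). split.
    - apply Rlt_le, Rinv_0_lt_compat; lra.
    - apply Rinv_le_contravar; lra. }
  assert (K := weighted_sum_nonneg (fun k => rho k - r k) (fun k => / rho k) n Hw).
  assert (Hd : forall k, 0 <= sum_f_R0 (fun k => rho k - r k) k).
  { intros k. rewrite minus_sum. specialize (H k). lra. }
  specialize (K Hd).
  assert (0 <= / rho n * sum_f_R0 (fun k => rho k - r k) n).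
  { apply Rmult_le_pos; auto. apply Rlt_le, Rinv_0_lt_compat, Hrho. }
  assert (sum_f_R0 (fun k => (rho k - r k) * / rho k) n
          <= sum_f_R0 (fun k => ln (rho k) - ln (r k)) n).
  { apply sum_Rle. intros k _. destruct (Hrho k) as [Hk _].
    assert (L := ln_le_sub (r k / rho k) ltac:(apply Rdiv_lt_0_compat; auto)).
    rewrite ln_div in L by auto.
    replace ((rho k - r k) * / rho k) with (1 - r k / rho k) by (field; lra). lra. }
  rewrite minus_sum in H1. lra.
Qed.

(** Bernoulli's inequality for [(1 + q) ^ n] is squared; the choice [q = eta / 3] gives
    [(1 + q) ^ 2 <= 1 + eta]. *)
Lemma square_le_geometric (eta : R) :
  0 < eta <= 1 -> exists C, 0 < C /\ forall n, INR n * INR n <= C * (1 + eta) ^ n.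
Proof.
  intros He. set (q := eta / 3). exists (/ (q * q)).
  assert (Hq : 0 < q) by (unfold q; lra). assert (Hqq : 0 < q * q) by nra.
  split; [now apply Rinv_0_lt_compat|]. intros n.
  apply (Rmult_le_reg_l (q * q)); auto.
  replace (q * q * (/ (q * q) * (1 + eta) ^ n)) with ((1 + eta) ^ n) by (field; lra).
  assert (P := poly n q Hq). assert (Hn := pos_INR n).
  assert (B : ((1 + q) * (1 + q)) ^ n <= (1 + eta) ^ n).
  { apply pow_incr. unfold q. split; nra. }
  rewrite Rpow_mult_distr in B.
  assert (INR n * q * (INR n * q) <= (1 + q) ^ n * (1 + q) ^ n)
    by (apply Rmult_le_compat; nra).
  lra.
Qed.

Lemma ln_le_linear (kappa : R) :
  0 < kappa -> exists C, forall x, 0 < x -> ln x <= kappa * x + C.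
Proof.
  intros Hk. exists (- ln kappa). intros x Hx.
  assert (K := ln_le_sub (kappa * x) ltac:(nra)). rewrite ln_mult in K by auto. lra.
Qed.

Lemma PSeries_exp (C q x : R) :
  entire (fun n => C * (q ^ n * / INR (Factorial.fact n))) /\
  PSeries (fun n => C * (q ^ n * / INR (Factorial.fact n))) x = C * exp (q * x).
Proof.
  assert (H : forall y, is_pseries (fun n => C * (q ^ n * / INR (Factorial.fact n))) y
                          (C * exp (q * y))).
  { intros y. apply is_pseries_R.
    apply (is_series_ext (fun n => C * (/ INR (Factorial.fact n) * (q * y) ^ n))).
    - intros n. eqR. rewrite Rpow_mult_distr. ring.
    - apply (is_series_scal (K := R_AbsRing) (V := R_NormedModule) C).
      apply is_pseries_R. apply is_exp_Reals. }
  split.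
  - apply entire_intro. intros y _. eexists. apply H.
  - apply is_pseries_unique. apply H.
Qed.

Lemma is_lim_0_squeeze (g : R -> R) (K : R) :
  (forall B, 1 < B -> 0 <= g B <= K / B) -> is_lim g p_infty 0.
Proof.
  intros H. apply is_lim_spec. intros eps. assert (He := cond_pos eps).
  exists (Rmax 1 (K / eps)). intros B HB.
  assert (M1 := Rmax_l 1 (K / eps)). assert (M2 := Rmax_r 1 (K / eps)).
  specialize (H B ltac:(lra)). rewrite Rminus_0_r, Rabs_pos_eq by lra.
  apply Rle_lt_trans with (1 := proj2 H). apply Rlt_div_l; [lra|].
  assert (K / eps < B) by lra. apply Rlt_div_l in H0; lra.
Qed.

Lemma is_lim_dilation (F : R -> R) (t l : R) :
  1 <= t -> is_lim F p_infty l -> is_lim (fun B => F (t * B)) p_infty l.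
Proof.
  intros Ht H. apply is_lim_spec. intros eps.
  destruct (is_lim_R_event F l eps H (cond_pos eps)) as [M HM].
  exists (Rmax M 0). intros B HB. apply HM.
  assert (M1 := Rmax_l M 0). assert (M2 := Rmax_r M 0). nra.
Qed.

Lemma int_to_exp : int_to (fun u => exp (-1 * u)) 1.
Proof.
  unfold int_to. apply (is_lim_ext_loc (fun B => 1 - exp (-1 * B))).
  - exists 0. intros B HB.
    rewrite (RInt_primitive (fun u => - exp (-1 * u))).
    + rewrite Rmult_0_r, exp_0. ring.
    + intros x _. auto_derive; auto. ring.
    + intros x _. apply (ex_derive_continuous (K := R_AbsRing) (V := R_NormedModule)).
      auto_derive. auto.
  - replace (Finite 1) with (Finite (1 - 0)) by (f_equal; ring).
    apply (is_lim_minus' (fun _ => 1)); [apply is_lim_const|].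
    apply (is_lim_0_squeeze _ 1). intros B HB. split; [apply Rlt_le, exp_pos|].
    replace (-1 * B) with (- B) by ring. rewrite exp_Ropp.
    unfold Rdiv. rewrite Rmult_1_l. apply Rinv_le_contravar; [lra|].
    assert (K := exp_ineq1_le B). lra.
Qed.

(** Since [exp y >= 1 + y + y ^ 2 / 2], it suffices that [(1 + y + y ^ 2 / 2) (1 - y + y ^ 2 / 2) =
    1 + y ^ 4 / 4] is at least 1. *)
Lemma exp_neg_le (y : R) : 0 <= y -> exp (- y) <= 1 - y + y * y / 2.
Proof.
  intros Hy. assert (K := exp_ge_taylor y 2 Hy). simpl in K.
  rewrite exp_Ropp. assert (P := exp_pos y).
  apply (Rmult_le_reg_l (exp y)); auto. rewrite Rinv_r by lra.
  apply Rle_trans with ((1 + y + y * y / 2) * (1 - y + y * y / 2)).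
  - assert (0 <= (y * y) * (y * y)) by nra. lra.
  - apply Rmult_le_compat_r; nra.
Qed.

Lemma cont0_continuity_pt (g : R -> R) (x : R) : cont0 g -> 0 <= x -> continuity_pt g x.
Proof. intros Cg Hx. apply continuity_pt_filterlim. now apply Cg. Qed.

Lemma continuity_pt_ex_derive (g : R -> R) (x : R) : ex_derive g x -> continuity_pt g x.
Proof.
  intros H. apply continuity_pt_filterlim.
  now apply (ex_derive_continuous (K := R_AbsRing) (V := R_NormedModule)).
Qed.

Lemma cont0_div (f g : R -> R) :
  cont0 f -> cont0 g -> (forall x, 0 <= x -> 0 < g x) -> cont0 (fun x => f x / g x).
Proof.
  intros Cf Cg Pg. apply cont0_mult; auto. intros x Hx.
  apply (continuous_comp g Rinv); auto. apply continuous_Rinv.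
  specialize (Pg x Hx). lra.
Qed.

Lemma cont0_entire (a : nat -> R) (s : R) :
  entire a -> cont0 (fun x => PSeries a (s * x)).
Proof.
  intros Ha. apply cont0_ex_derive. intros x _. auto_derive.
  now apply ex_derive_entire.
Qed.

Lemma cont0_entire1 (a : nat -> R) : entire a -> cont0 (fun x => PSeries a x).
Proof. intros Ha. apply cont0_ex_derive. intros x _. now apply ex_derive_entire. Qed.

Lemma cont0_id : cont0 (fun x => x).
Proof. intros x _. apply continuous_id. Qed.

Lemma cont0_pow (k : nat) : cont0 (fun x => x ^ k).
Proof. apply cont0_ex_derive. intros x _. auto_derive; auto. Qed.

Lemma cont0_exp (k : R) : cont0 (fun x => exp (k * x)).
Proof. apply cont0_ex_derive. intros x _. auto_derive; auto. Qed.

Lemma cont0_minus (f g : R -> R) :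
  cont0 f -> cont0 g -> cont0 (fun x => f x - g x).
Proof.
  intros Hf Hg x Hx.
  apply (continuous_minus (K := R_AbsRing) (V := R_NormedModule)); auto.
Qed.

Ltac cont :=
  try assumption;
  lazymatch goal with
  | |- cont0 (fun _ => ?k) => apply (cont0_const k)
  | |- cont0 (fun x => x) => apply cont0_id
  | |- cont0 (fun x => x ^ ?k) => apply (cont0_pow k)
  | |- cont0 (fun x => exp (?k * x)) => apply (cont0_exp k)
  | |- cont0 (fun x => @?u x + @?v x) => apply (cont0_plus u v); cont
  | |- cont0 (fun x => @?u x - @?v x) => apply (cont0_minus u v); cont
  | |- cont0 (fun x => @?u x * @?v x) => apply (cont0_mult u v); cont
  | |- cont0 (fun x => PSeries ?a (?s * x)) => apply (cont0_entire a s); try assumption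
  | |- cont0 (fun x => PSeries ?a x) => apply (cont0_entire1 a); try assumption
  | |- cont0 (PSeries ?a) => apply (cont0_entire1 a); try assumption
  | |- cont0 (fun x => @?u x / @?v x) => apply (cont0_div u v); cont
  | _ => idtac
  end.

(** A Riemann integrable function is bounded, whereas a series going from 1 to a nonpositive value
    takes arbitrarily small positive values on the way, where its inverse is large. *)
Lemma positive_of_integrable_inverse (a : nat -> R) (B0 : R) :
  entire a -> PSeries a 0 = 1 ->
  (forall B, B0 < B -> ex_RInt (fun x => / PSeries a x) 0 B) ->
  forall x, 0 <= x -> 0 < PSeries a x.
Proof.
  intros Ha H0 HI x Hx. apply Rnot_le_lt. intros Hneg.
  set (B := Rmax B0 x + 1).
  assert (HB : B0 < B /\ x < B).
  { unfold B. assert (K1 := Rmax_l B0 x). assert (K2 := Rmax_r B0 x). lra. }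
  destruct (ex_RInt_ub (V := R_NormedModule) _ _ _ (HI B (proj1 HB))) as [M HM].
  assert (HM' : forall t, 0 <= t <= B -> Rabs (/ PSeries a t) <= M).
  { intros t Ht. apply HM. rewrite Rmin_left, Rmax_right by lra. exact Ht. }
  (* A value in (0, 1) whose inverse exceeds [M]. It is positive because the inverse of 0 carries no
     information. *)
  set (v := / (Rmax M 1 + 1)).
  assert (Hm : M < Rmax M 1 + 1 /\ 1 < Rmax M 1 + 1).
  { assert (K1 := Rmax_l M 1). assert (K2 := Rmax_r M 1). lra. }
  assert (Hv : 0 < v < 1).
  { unfold v. split; [apply Rinv_0_lt_compat; lra|].
    apply (Rmult_lt_reg_l (Rmax M 1 + 1)); [lra|]. rewrite Rinv_r; lra. }
  destruct (IVT_gen (PSeries a) 0 x v) as [y [Hy Hfy]].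
  - intros z. now apply continuity_entire.
  - rewrite H0, Rmin_right, Rmax_left by lra. lra.
  - rewrite Rmin_left, Rmax_right in Hy by lra.
    assert (K := HM' y ltac:(lra)). rewrite Hfy in K. unfold v in K.
    rewrite Rinv_inv, Rabs_pos_eq in K; lra.
Qed.

Lemma param_derive (A A' : R -> R -> R) (B s : R) :
  0 <= B -> (forall u, cont0 (A u)) ->
  (forall u v, is_derive (fun z => A z v) u (A' u v)) ->
  (forall v, 0 <= v -> continuity_2d_pt A' s v) ->
  is_derive (fun u => RInt (A u) 0 B) s (RInt (A' s) 0 B).
Proof.
  intros HB CA HD HC.
  replace (RInt (A' s) 0 B) with (RInt (fun t => Derive (fun u => A u t) s) 0 B).
  - apply (is_derive_RInt_param A 0 B s).
    + apply filter_forall. intros u t _. eexists. apply HD.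
    + rewrite Rmin_left by lra. intros t [Ht _].
      apply (continuity_2d_pt_ext A').
      * intros u v. symmetry. apply is_derive_unique. apply HD.
      * now apply HC.
    + apply filter_forall. intros u. apply cont0_ex_RInt; auto; lra.
  - apply RInt_ext. intros t _. apply is_derive_unique. apply HD.
Qed.

Lemma continuity_2d_pt_entire_div (a b : nat -> R) (s v : R) :
  entire a -> entire b -> PSeries b v <> 0 ->
  continuity_2d_pt (fun u v => PSeries a (u * v) / PSeries b v) s v.
Proof.
  intros Ha Hb Hv. apply continuity_2d_pt_mult.
  - apply (continuity_1d_2d_pt_comp (PSeries a) (fun u v => u * v)).
    + now apply continuity_entire.
    + apply continuity_2d_pt_mult;
        [apply continuity_2d_pt_id1 | apply continuity_2d_pt_id2].
  - apply continuity_2d_pt_inv; auto.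
    apply (continuity_1d_2d_pt_comp (PSeries b) (fun _ v => v)).
    + now apply continuity_entire.
    + apply continuity_2d_pt_id2.
Qed.

(* [y * PSeries (average c) y] is the primitive of [PSeries c] vanishing at 0. *)
Definition average (c : nat -> R) (n : nat) : R := c n / INR (S n).

Lemma average_incr (c : nat -> R) (n : nat) : PS_incr_1 (average c) n = PS_Int c n.
Proof. destruct n; reflexivity. Qed.

Lemma entire_average (c : nat -> R) : entire c -> entire (average c).
Proof.
  intros H. unfold entire.
  rewrite <- CV_radius_incr_1, (CV_radius_ext _ _ (average_incr c)).
  rewrite CV_radius_Int. exact H.
Qed.

Lemma average_primitive (c : nat -> R) (y : R) :
  entire c -> y * PSeries (average c) y = RInt (PSeries c) 0 y.
Proof.
  intros H. rewrite RInt_PSeries by now apply entire_lt.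
  rewrite <- PSeries_incr_1. apply PSeries_ext. apply average_incr.
Qed.

(** On coefficients this is [(1 + n) * (c n / (n + 1)) = c n]. *)
Lemma is_derive_average (c : nat -> R) (u v : R) :
  entire c ->
  is_derive (fun u => u * PSeries (average c) (u * v)) u (PSeries c (u * v)).
Proof.
  intros H. assert (Hq := entire_average c H).
  auto_derive.
  - now apply ex_derive_entire.
  - rewrite Derive_entire by auto.
    transitivity (PSeries (average c) (u * v) + PSeries (euler (average c)) (u * v)).
    + rewrite PSeries_euler. eqR. ring.
    + rewrite <- PSeries_plus by (apply entire_ex; auto; now apply entire_euler).
      apply PSeries_ext. intros n. unfold PS_plus, euler, average.
      change (c n / INR (S n) + INR n * (c n / INR (S n)) = c n).
      rewrite S_INR. assert (K := pos_INR n). field. lra.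
Qed.

Lemma inv_one_minus_le (s t : R) : s <= t < 1 -> 1 / (1 - s) <= 1 / (1 - t).
Proof.
  intros H. unfold Rdiv. rewrite !Rmult_1_l. apply Rinv_le_contravar; lra.
Qed.

Lemma neg_ln_bounds (s : R) : 0 <= s < 1 -> 0 <= - ln (1 - s) <= s / (1 - s).
Proof.
  intros Hs. split.
  - assert (K := ln_le_sub (1 - s) ltac:(lra)). lra.
  - rewrite <- ln_Rinv by lra.
    assert (K := ln_le_sub (/ (1 - s)) ltac:(apply Rinv_0_lt_compat; lra)).
    replace (s / (1 - s)) with (/ (1 - s) - 1) by (field; lra). exact K.
Qed.

Lemma int_to_sum (g : nat -> R -> R) (l : nat -> R) (n : nat) :
  (forall k, cont0 (g k)) -> (forall k, int_to (g k) (l k)) ->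
  cont0 (fun x => sum_f_R0 (fun k => g k x) n) /\
  int_to (fun x => sum_f_R0 (fun k => g k x) n) (sum_f_R0 l n).
Proof.
  intros Cg Hg. induction n as [|n [IHc IHi]].
  { split; [apply (Cg 0%nat) | apply (Hg 0%nat)]. }
  split.
  - exact (cont0_plus _ _ IHc (Cg (S n))).
  - exact (int_to_plus _ _ _ _ IHc (Cg (S n)) IHi (Hg (S n))).
Qed.

(** After multiplication by [s] the remainder has derivative [t ^ S K / (1 - t)], at most
    [2 * s ^ S K] for [t <= s <= 1 / 2]. The mean value theorem gives back the factor [s]. *)
Lemma neg_ln_Taylor (K : nat) (s : R) : 0 < s <= / 2 ->
  Rabs (- ln (1 - s) / s - sum_f_R0 (fun k => s ^ k / INR (S k)) K) <= 2 * s ^ S K.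
Proof.
  intros Hs.
  set (g := fun t => - ln (1 - t) - sum_f_R0 (fun k => t ^ S k / INR (S k)) K).
  set (dg := fun t => / (1 - t) - sum_f_R0 (fun k => t ^ k) K).
  assert (Hd : forall t, t < 1 -> is_derive g t (dg t)).
  { intros t Ht. unfold g, dg.
    apply (is_derive_minus (K := R_AbsRing) (V := R_NormedModule)
             (fun t => - ln (1 - t)) (fun t => sum_f_R0 (fun k => t ^ S k / INR (S k)) K)).
    - auto_derive; [lra|]. field. lra.
    - clear. induction K as [|K IH].
      + simpl. auto_derive; auto. field.
      + cbn [sum_f_R0].
        apply (is_derive_plus (K := R_AbsRing) (V := R_NormedModule)
             (fun t => sum_f_R0 (fun k => t ^ S k / INR (S k)) K)
             (fun t => t ^ S (S K) / INR (S (S K)))); auto.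
        assert (HN := not_0_INR (S (S K)) ltac:(lia)).
        auto_derive; auto.
        change (match K with 0%nat => 1 | S _ => INR K + 1 end) with (INR (S K)).
        rewrite S_INR in HN. simpl pow. field. exact HN. }
  assert (Hdg : forall t, 0 <= t <= s -> 0 <= dg t <= 2 * s ^ S K).
  { intros t Ht. unfold dg. rewrite tech3 by lra.
    replace (/ (1 - t) - (1 - t ^ S K) / (1 - t)) with (t ^ S K / (1 - t)) by (field; lra).
    assert (P : 0 <= t ^ S K) by (apply pow_le; lra).
    split; [apply Rdiv_le_0_compat; lra|].
    assert (t ^ S K <= s ^ S K) by (apply pow_incr; lra).
    apply Rle_div_l; [lra|]. nra. }
  destruct (MVT_gen g 0 s dg) as [xi [Hxi E1]].
  - rewrite Rmin_left, Rmax_right by lra. intros x Hx. apply Hd. lra.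
  - rewrite Rmin_left, Rmax_right by lra. intros x Hx.
    apply continuity_pt_ex_derive. eexists. apply Hd. lra.
  - rewrite Rmin_left, Rmax_right in Hxi by lra.
    assert (G0 : g 0 = 0).
    { unfold g. rewrite Rminus_0_r, ln_1. rewrite (sum_eq _ (fun _ => 0)).
      - rewrite sum_cte. ring.
      - intros i _. simpl. unfold Rdiv. ring. }
    rewrite G0, !Rminus_0_r in E1.
    replace (- ln (1 - s) / s - sum_f_R0 (fun k => s ^ k / INR (S k)) K) with (dg xi).
    + specialize (Hdg xi Hxi). rewrite Rabs_pos_eq; lra.
    + apply (Rmult_eq_reg_r s); [|lra]. rewrite <- E1. unfold g.
      replace (sum_f_R0 (fun k => s ^ S k / INR (S k)) K)
        with (sum_f_R0 (fun k => s ^ k / INR (S k)) K * s); [field; lra|].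
      rewrite Rmult_comm, scal_sum. apply sum_eq. intros i _.
      change (s ^ S i) with (s * s ^ i). unfold Rdiv. ring.
Qed.

(** * Moments of [dx / f x] *)

Section Balanced.

Context (beta : R) (c : nat -> R).
Hypothesis beta_bounds : 0 <= beta < 1.
Hypothesis c_entire : entire c.
Hypothesis f_at_0 : PSeries c 0 = 1.
Hypothesis balanced : balanced_eq beta (PSeries c).

Notation f := (PSeries c).
Notation Q := (PSeries (average c)).

(** At [s = 0] the equation says that [1 / f] is integrable, because [f 0 = 1]. *)
Lemma f_pos (x : R) : 0 <= x -> 0 < f x.
Proof.
  destruct (is_RInt_gen_int_to _ _ (balanced 0 ltac:(lra))) as [[B0 HB0] _].
  apply positive_of_integrable_inverse with (B0 := B0); auto.
  intros B HB. apply (ex_RInt_ext (fun x => f (0 * x) / f x)); auto.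
  intros y _. rewrite Rmult_0_l, f_at_0. eqR. unfold Rdiv. ring.
Qed.

Lemma f_neq_0 (x : R) : 0 <= x -> f x <> 0.
Proof. intros Hx. assert (K := f_pos x Hx). lra. Qed.

Lemma c_0 : c 0%nat = 1.
Proof. rewrite <- f_at_0. symmetry. apply PSeries_0. Qed.

Lemma average_entire : entire (average c).
Proof. now apply entire_average. Qed.

Lemma Q_pos (y : R) : 0 <= y -> 0 < Q y.
Proof.
  intros [Hy|<-].
  - assert (K : 0 < y * Q y); [|nra].
    rewrite average_primitive by auto. apply RInt_gt_0; auto.
    + intros x Hx. apply f_pos. lra.
    + intros x Hx. apply cont0_entire1; auto; lra.
  - rewrite PSeries_0. unfold average. rewrite c_0. simpl. lra.
Qed.

Lemma cont0_over_f (g : R -> R) : cont0 g -> cont0 (fun x => g x / f x).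
Proof. intros Hg. apply cont0_div; auto. now apply cont0_entire1. exact f_pos. Qed.

Lemma cont0_Phi (s : R) : cont0 (fun x => f (s * x) / f x).
Proof. apply cont0_over_f. now apply cont0_entire. Qed.

Lemma cont0_Q (s : R) : cont0 (fun x => Q (s * x) / f x).
Proof. apply cont0_over_f. apply cont0_entire, average_entire. Qed.

Lemma cont0_E (s : R) : cont0 (fun x => s * Q (s * x) / f x).
Proof.
  apply cont0_over_f. apply cont0_mult. apply cont0_const.
  apply cont0_entire, average_entire.
Qed.

Lemma balanced_int_to (s : R) :
  0 <= s < 1 -> int_to (fun x => f (s * x) / f x) (1 / (1 - s) - beta).
Proof. intros Hs. now apply is_RInt_gen_int_to, balanced. Qed.

(** * The equation integrated in [s] *)

Definition Phi (B s : R) : R := RInt (fun x => f (s * x) / f x) 0 B.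
(** The primitive of [Phi B] vanishing at 0: [s * Q (s * x)] is the integral of [f (r * x)] for [r]
    from 0 to [s]. *)
Definition E (B s : R) : R := RInt (fun x => s * Q (s * x) / f x) 0 B.

Lemma Phi_pos (s x : R) : 0 <= s -> 0 <= x -> 0 <= f (s * x) / f x.
Proof.
  intros Hs Hx. apply Rlt_le, Rdiv_lt_0_compat; apply f_pos; auto.
  now apply Rmult_le_pos.
Qed.

Lemma E_pos (s x : R) : 0 <= s -> 0 <= x -> 0 <= s * Q (s * x) / f x.
Proof.
  intros Hs Hx. apply Rdiv_le_0_compat; [|now apply f_pos].
  apply Rmult_le_pos; auto. apply Rlt_le, Q_pos. now apply Rmult_le_pos.
Qed.

Lemma Phi_ub (B s : R) : 0 <= B -> 0 <= s < 1 -> Phi B s <= 1 / (1 - s) - beta.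
Proof.
  intros HB Hs. apply int_to_ub; auto.
  - apply cont0_Phi.
  - intros x Hx. apply Phi_pos; lra.
  - now apply balanced_int_to.
Qed.

Lemma is_derive_E (B s : R) : 0 <= B -> is_derive (E B) s (Phi B s).
Proof.
  intros HB.
  apply (param_derive (fun s x => s * Q (s * x) / f x) (fun s x => f (s * x) / f x));
    auto.
  - intros u. apply cont0_E.
  - intros u v. unfold Rdiv.
    apply (is_derive_ext (fun z => / f v * (z * Q (z * v)))).
    + intros t. apply Rmult_comm.
    + rewrite (Rmult_comm (f (u * v))).
      apply (is_derive_scal (fun z => z * Q (z * v)) u (/ f v)).
      now apply is_derive_average.
  - intros v Hv. apply continuity_2d_pt_entire_div; auto. now apply f_neq_0.
Qed.

Lemma continuity_Phi (B s : R) : 0 <= B -> continuity_pt (Phi B) s.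
Proof.
  intros HB. apply continuity_pt_ex_derive.
  assert (Hd := entire_derive c c_entire).
  exists (RInt (fun x => x * (PSeries (PS_derive c) (s * x) / f x)) 0 B).
  apply (param_derive (fun s x => f (s * x) / f x)
           (fun s x => x * (PSeries (PS_derive c) (s * x) / f x))); auto.
  - intros u. apply cont0_Phi.
  - intros u v. auto_derive.
    + now apply ex_derive_entire.
    + rewrite Derive_entire by auto. unfold Rdiv. ring.
  - intros v Hv. apply continuity_2d_pt_mult; [apply continuity_2d_pt_id2|].
    apply continuity_2d_pt_entire_div; auto. now apply f_neq_0.
Qed.

Lemma E_mean_value (B s t : R) :
  0 <= B -> s <= t -> exists xi, s <= xi <= t /\ E B t - E B s = Phi B xi * (t - s).
Proof.
  intros HB Hst.
  destruct (MVT_gen (E B) s t (Phi B)) as [xi [Hxi HE]].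
  - intros x _. now apply is_derive_E.
  - intros x _. apply continuity_pt_ex_derive.
    eexists. now apply is_derive_E.
  - rewrite Rmin_left, Rmax_right in Hxi by auto. now exists xi.
Qed.

Lemma E_at_0 (B : R) : E B 0 = 0.
Proof.
  transitivity (RInt (fun _ : R => 0) 0 B).
  - apply RInt_ext. intros x _. eqR. unfold Rdiv. ring.
  - rewrite RInt_const_R. eqR. ring.
Qed.

Lemma E_increment_ub (B s t : R) :
  0 <= B -> 0 <= s <= t -> t < 1 -> E B t - E B s <= (1 / (1 - t) - beta) * (t - s).
Proof.
  intros HB Hs Ht. destruct (E_mean_value B s t HB) as [xi [Hxi ->]]; try lra.
  apply Rmult_le_compat_r; [lra|].
  apply Rle_trans with (1 / (1 - xi) - beta); [apply Phi_ub; lra|].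
  assert (K := inv_one_minus_le xi t ltac:(lra)). lra.
Qed.

(** The bound is uniform in [B], which makes the increasing limit [E_lim] finite. *)
Lemma E_ub (B s : R) : 0 <= B -> 0 <= s < 1 -> E B s <= s / (1 - s).
Proof.
  intros HB Hs. assert (K := E_increment_ub B 0 s HB ltac:(lra) ltac:(lra)).
  rewrite E_at_0 in K. unfold Rdiv in *. nra.
Qed.

Definition E_lim (s : R) : R := real (Lim (fun B => E B s) p_infty).

Lemma E_lim_correct (s : R) :
  0 <= s < 1 -> int_to (fun x => s * Q (s * x) / f x) (E_lim s).
Proof.
  intros Hs. destruct (int_to_bounded (fun x => s * Q (s * x) / f x) (s / (1 - s)))
    as [l Hl].
  - apply cont0_E.
  - intros x Hx. apply E_pos; lra.
  - intros B HB. now apply E_ub.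
  - unfold E_lim. now rewrite (is_lim_unique (fun B => E B s) _ _ Hl).
Qed.

(* The lower bound on the difference quotients uses that [Phi B] increases with [B]
   and that each [Phi B] is continuous. *)
Lemma is_derive_E_lim (s : R) :
  0 < s < 1 -> is_derive E_lim s (1 / (1 - s) - beta).
Proof.
  intros Hs. apply is_derive_Reals. intros eps Heps.
  destruct (is_lim_R_event _ _ (eps / 4) (balanced_int_to s ltac:(lra)) ltac:(lra))
    as [B1 HB1].
  set (B0 := Rmax B1 0 + 1).
  assert (HB0 : B1 < B0 /\ 0 <= B0).
  { unfold B0. assert (K1 := Rmax_l B1 0). assert (K2 := Rmax_r B1 0). lra. }
  specialize (HB1 B0 (proj1 HB0)). fold (Phi B0 s) in HB1. apply Rabs_def2 in HB1.
  assert (C1 : exists d, 0 < d /\ forall t, Rabs (t - s) < d ->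
     Rabs (Phi B0 t - Phi B0 s) < eps / 4).
  { destruct (continuity_Phi B0 s (proj2 HB0) (eps / 4) ltac:(lra)) as [d [Hd K]].
    exists d. split; auto. intros t Ht. destruct (Req_dec s t) as [<-|Hn].
    - rewrite Rminus_diag, Rabs_R0. lra.
    - apply K. split; auto. now split. }
  assert (C2 : exists d, 0 < d /\ forall t, Rabs (t - s) < d ->
     Rabs (1 / (1 - t) - 1 / (1 - s)) < eps / 4).
  { assert (Hc : continuity_pt (fun t => 1 / (1 - t)) s).
    { apply continuity_pt_ex_derive.
      auto_derive. lra. }
    destruct (Hc (eps / 4) ltac:(lra)) as [d [Hd K]].
    exists d. split; auto. intros t Ht. destruct (Req_dec s t) as [<-|Hn].
    - rewrite Rminus_diag, Rabs_R0. lra.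
    - apply K. split; auto. now split. }
  destruct C1 as [d1 [Hd1 K1]]. destruct C2 as [d2 [Hd2 K2]].
  set (d := Rmin (Rmin d1 d2) (Rmin s (1 - s))).
  assert (Hd : 0 < d) by (repeat apply Rmin_pos; lra).
  assert (Hdl : d <= d1 /\ d <= d2 /\ d <= s /\ d <= 1 - s).
  { unfold d. assert (M1 := Rmin_l (Rmin d1 d2) (Rmin s (1 - s))).
    assert (M2 := Rmin_r (Rmin d1 d2) (Rmin s (1 - s))).
    assert (M3 := Rmin_l d1 d2). assert (M4 := Rmin_r d1 d2).
    assert (M5 := Rmin_l s (1 - s)). assert (M6 := Rmin_r s (1 - s)). lra. }
  set (l := 1 / (1 - s) - beta) in *.
  assert (Main : forall a b, a < b -> Rabs (a - s) < d -> Rabs (b - s) < d ->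
            (l - eps / 2) * (b - a) <= E_lim b - E_lim a <= (l + eps / 2) * (b - a)).
  { intros a b Hab Ha Hb.
    assert (Hb2 := K2 b ltac:(lra)). apply Rabs_def2 in Hb2.
    assert (Ha' := Ha). assert (Hb' := Hb).
    apply Rabs_def2 in Ha'. apply Rabs_def2 in Hb'.
    assert (L : is_lim (fun B => E B b - E B a) p_infty (E_lim b - E_lim a)).
    { apply (is_lim_minus' _ _ p_infty (E_lim b) (E_lim a)); apply E_lim_correct; lra. }
    split.
    - apply (is_lim_R_lb _ B0 _ _) with (2 := L). intros B HB.
      destruct (E_mean_value B a b ltac:(lra) ltac:(lra)) as [xi [Hxi ->]].
      apply Rmult_le_compat_r; [lra|].
      assert (Hx := K1 xi). assert (Rabs (xi - s) < d1) by (apply Rabs_def1; lra).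
      specialize (Hx H). apply Rabs_def2 in Hx.
      assert (Phi B0 xi <= Phi B xi).
      { apply RInt_incr0; try lra. apply cont0_Phi.
        intros x Hx0. apply Phi_pos; lra. }
      lra.
    - apply (is_lim_R_ub _ B0 _ _) with (2 := L). intros B HB.
      apply Rle_trans with (1 := E_increment_ub B a b ltac:(lra) ltac:(lra) ltac:(lra)).
      apply Rmult_le_compat_r; unfold l; lra. }
  exists (mkposreal d Hd). intros h Hh0 Hh. simpl in Hh.
  assert (Hsh : Rabs (s + h - s) < d) by (now replace (s + h - s) with h by ring).
  assert (Hss : Rabs (s - s) < d) by (rewrite Rminus_diag, Rabs_R0; lra).
  assert (Z : forall z, (l - eps / 2) <= z <= (l + eps / 2) -> Rabs (z - l) < eps).
  { intros z Hz. apply Rabs_def1; lra. }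
  destruct (Rlt_or_le 0 h) as [Hp|Hn].
  - assert (M := Main s (s + h) ltac:(lra) Hss Hsh).
    replace (s + h - s) with h in M by ring. apply Z.
    split; [apply Rle_div_r | apply Rle_div_l]; lra.
  - assert (Hn' : h < 0) by lra.
    assert (M := Main (s + h) s ltac:(lra) Hsh Hss).
    replace (s - (s + h)) with (- h) in M by ring. apply Z.
    replace ((E_lim (s + h) - E_lim s) / h) with ((E_lim s - E_lim (s + h)) / - h)
      by (field; lra).
    split; [apply Rle_div_r | apply Rle_div_l]; lra.
Qed.

(** [E_lim] and [- ln (1 - s) - beta * s] have the same derivative on (0, 1), and both are [O(s)] at
    0, so their difference [D] is the constant 0. *)
Lemma int_to_Q (s : R) :
  0 < s < 1 -> int_to (fun x => s * Q (s * x) / f x) (- ln (1 - s) - beta * s).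
Proof.
  intros Hs.
  set (D := fun s => E_lim s + ln (1 - s) + beta * s).
  assert (HD : forall t, 0 < t < 1 -> is_derive D t 0).
  { intros t Ht. unfold D.
    replace 0 with ((1 / (1 - t) - beta) + - / (1 - t) + beta) by (field; lra).
    apply (is_derive_plus (K := R_AbsRing) (V := R_NormedModule)
             (fun s => E_lim s + ln (1 - s)) (fun s => beta * s)).
    - apply (is_derive_plus (K := R_AbsRing) (V := R_NormedModule)
               E_lim (fun s => ln (1 - s))).
      + now apply is_derive_E_lim.
      + auto_derive; [lra|]. field. lra.
    - auto_derive; auto. ring. }
  assert (HD1 : forall a, 0 < a <= s -> D s = D a).
  { intros a Ha. destruct (MVT_gen D a s (fun _ => 0)) as [xi [_ K]].
    - rewrite Rmin_left, Rmax_right by lra. intros x Hx. apply HD. lra.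
    - rewrite Rmin_left, Rmax_right by lra. intros x Hx.
      apply continuity_pt_ex_derive.
      eexists. apply HD. lra.
    - lra. }
  assert (HD2 : forall a, 0 < a <= / 2 -> Rabs (D a) <= 5 * a).
  { intros a Ha. unfold D.
    assert (N := neg_ln_bounds a ltac:(lra)).
    assert (HE : 0 <= E_lim a <= a / (1 - a)).
    { split.
      - apply (is_lim_R_lb (fun B => E B a) 0); [|apply E_lim_correct; lra].
        intros B HB. apply RInt_ge00; try lra. apply cont0_E.
        intros x Hx. apply E_pos; lra.
      - apply (is_lim_R_ub (fun B => E B a) 0); [|apply E_lim_correct; lra].
        intros B HB. apply E_ub; lra. }
    assert (a / (1 - a) <= 2 * a) by (apply Rle_div_l; nra).
    assert (0 <= beta * a <= a) by nra.
    apply Rabs_le. lra. }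
  assert (HD0 : D s = 0).
  { destruct (Req_dec (D s) 0) as [|Hn]; auto. exfalso.
    assert (Hp : 0 < Rabs (D s)) by now apply Rabs_pos_lt.
    (* Small enough for [5 * a < Rabs (D s)], while [D a = D s]. *)
    set (a := Rmin (Rmin s (/ 2)) (Rabs (D s) / 10)).
    assert (Ha : 0 < a) by (repeat apply Rmin_pos; lra).
    assert (M1 := Rmin_l (Rmin s (/ 2)) (Rabs (D s) / 10)).
    assert (M2 := Rmin_r (Rmin s (/ 2)) (Rabs (D s) / 10)).
    assert (M3 := Rmin_l s (/ 2)). assert (M4 := Rmin_r s (/ 2)).
    fold a in M1, M2.
    assert (K := HD2 a ltac:(lra)). rewrite <- (HD1 a) in K by lra. lra. }
  replace (- ln (1 - s) - beta * s) with (E_lim s) by (unfold D in HD0; lra).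
  apply E_lim_correct. lra.
Qed.

(** * Growth of the primitive [P y = y * Q y] of [f] *)

Lemma P_incr (a b : R) : 0 <= a <= b -> a * Q a <= b * Q b.
Proof.
  intros H. rewrite !average_primitive by auto.
  apply RInt_incr0; auto.
  - now apply cont0_entire1.
  - intros x Hx. now apply Rlt_le, f_pos.
Qed.

Lemma P_pos (y : R) : 0 < y -> 0 < y * Q y.
Proof. intros Hy. apply Rmult_lt_0_compat; auto. apply Q_pos. lra. Qed.

(* Cauchy-Schwarz on [2y, 4y], in the form [/ f >= 2 * l - l ^ 2 * f]. *)
Lemma P_growth (y : R) : 0 < y -> y * (y * Q y) <= 4 * y * Q (4 * y).
Proof.
  intros Hy. set (p := y * Q y). set (p4 := 4 * y * Q (4 * y)).
  assert (Hp : 0 < p) by now apply P_pos.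
  assert (Hp4 : 0 < p4) by (apply P_pos; lra).
  (* The maximiser of [4 * y * l - l ^ 2 * p4]; the maximum is [4 * y ^ 2 / p4]. *)
  set (l := 2 * y / p4). assert (Hl : 0 < l) by (apply Rdiv_lt_0_compat; lra).
  assert (Hk : 0 < p / (4 * y)) by (apply Rdiv_lt_0_compat; lra).
  assert (HE : RInt (fun x => / 2 * Q (/ 2 * x) / f x) (2 * y) (4 * y) <= 1).
  { assert (K := E_ub (4 * y) (/ 2) ltac:(lra) ltac:(lra)). unfold E in K.
    rewrite <- (RInt_Chasles0 _ 0 (2 * y)) in K; try apply cont0_E; try lra.
    assert (0 <= RInt (fun x => / 2 * Q (/ 2 * x) / f x) 0 (2 * y)).
    { apply RInt_ge00; try lra. apply cont0_E. intros x Hx. apply E_pos; lra. }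
    lra. }
  assert (HI : RInt f (2 * y) (4 * y) = p4 - 2 * y * Q (2 * y)).
  { unfold p4. rewrite !average_primitive by auto.
    rewrite <- (RInt_Chasles0 f 0 (2 * y) (4 * y)); try lra. now apply cont0_entire1. }
  assert (H2 := P_pos (2 * y) ltac:(lra)).
  assert (HL : p / (4 * y) * ((4 * y - 2 * y) * (2 * l) - l * l * (p4 - 2 * y * Q (2 * y)))
               <= RInt (fun x => / 2 * Q (/ 2 * x) / f x) (2 * y) (4 * y)).
  { rewrite <- HI.
    replace ((4 * y - 2 * y) * (2 * l) - l * l * RInt f (2 * y) (4 * y))
      with (RInt (fun _ => 2 * l) (2 * y) (4 * y) + (- (l * l)) * RInt f (2 * y) (4 * y))
      by (rewrite RInt_const_R; ring).
    assert (Cl : cont0 (fun x => - (l * l) * f x)) by cont.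
    assert (Ck : cont0 (fun x => 2 * l + - (l * l) * f x)) by cont.
    rewrite <- (RInt_scal0 f) by (try lra; cont).
    rewrite <- (RInt_plus0 (fun _ => 2 * l) (fun x => - (l * l) * f x))
      by (try lra; cont).
    rewrite <- (RInt_scal0 (fun x => 2 * l + - (l * l) * f x)) by (try lra; cont).
    apply RInt_le0; [cont | apply cont0_E | lra |].
    intros x Hx. assert (Hf := f_pos x ltac:(lra)).
    apply Rle_trans with (p / (4 * y) * / f x).
    - apply Rmult_le_compat_l; [lra|].
      apply (Rmult_le_reg_r (f x)); auto. rewrite Rinv_l by lra.
      assert (0 <= (l * f x - 1) ^ 2) by apply pow2_ge_0. nra.
    - apply Rmult_le_compat_r; [now apply Rlt_le, Rinv_0_lt_compat|].
      (* Here [y <= x / 2] and [x <= 4 * y], so [Q (x / 2) / 2 = P (x / 2) / x >= p / (4 * y)]. *)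
      assert (M := P_incr y (/ 2 * x) ltac:(lra)). fold p in M.
      apply Rle_div_l; [lra|].
      assert (0 < Q (/ 2 * x)) by (apply Q_pos; lra). nra. }
  assert (HF : p / (4 * y) * ((4 * y - 2 * y) * (2 * l) - l * l * p4) <= 1).
  { apply Rle_trans with (2 := HE). apply Rle_trans with (2 := HL).
    apply Rmult_le_compat_l; [lra|].
    assert (0 <= l * l * (2 * y * Q (2 * y))) by (apply Rmult_le_pos; nra). lra. }
  replace (p / (4 * y) * ((4 * y - 2 * y) * (2 * l) - l * l * p4))
    with (y * p / p4) in HF by (unfold l; field; lra).
  apply Rle_div_l in HF; lra.
Qed.

(** From index [A] on, the argument [4 ^ j * y] is at least [4 ^ A], so each application of
    [P_growth] gains a factor [4 ^ A]. Before that only monotonicity is used, and the constant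
    [4 ^ (A * A)] pays for it. *)
Lemma P_growth_iter (A j : nat) (y : R) :
  1 <= y -> 4 ^ (A * j) * (y * Q y) <= 4 ^ (A * A) * (4 ^ j * y * Q (4 ^ j * y)).
Proof.
  intros Hy. assert (Hp := P_pos y ltac:(lra)).
  assert (H4 : forall n, 1 <= 4 ^ n) by (intros n; apply pow_R1_Rle; lra).
  induction j as [|j IH].
  - rewrite Nat.mul_0_r. simpl (4 ^ 0). rewrite !Rmult_1_l.
    assert (K := H4 (A * A)%nat). nra.
  - destruct (Nat.le_gt_cases A j) as [Hj|Hj].
    + assert (G := P_growth (4 ^ j * y)). assert (Hj4 := H4 j).
      assert (Hz : 0 < 4 ^ j * y) by nra. specialize (G Hz).
      replace (4 ^ S j * y) with (4 * (4 ^ j * y)) by (simpl; ring).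
      replace (A * S j)%nat with (A + A * j)%nat by lia. rewrite pow_add.
      assert (HA : 4 ^ A <= 4 ^ j * y).
      { assert (4 ^ A <= 4 ^ j) by (apply Rle_pow; [lra|lia]). nra. }
      assert (P1 := P_pos _ Hz).
      apply Rle_trans with (4 ^ A * (4 ^ (A * A) * (4 ^ j * y * Q (4 ^ j * y)))).
      * rewrite Rmult_assoc. apply Rmult_le_compat_l; auto. apply pow_le; lra.
      * rewrite <- Rmult_assoc, (Rmult_comm (4 ^ A)), Rmult_assoc.
        apply Rmult_le_compat_l; [apply pow_le; lra|].
        apply Rle_trans with (2 := G). apply Rmult_le_compat_r; lra.
    + apply Rmult_le_compat; try lra.
      * apply pow_le; lra.
      * apply Rle_pow; [lra|]. apply Nat.mul_le_mono_l. lia.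
      * apply P_incr. split; [lra|]. assert (K := H4 (S j)). nra.
Qed.

(** [P_growth] raises the degree by one: apply the bound for [k] at [z / 4]. This requires
    [z / 4 >= 1]; for [z] in [1, 4] the term [C2] relies on [P z >= P 1 > 0] alone. *)
Lemma pow_le_P (k : nat) : exists C, 0 <= C /\ forall y, 1 <= y -> y ^ k <= C * (y * Q y).
Proof.
  assert (P1 := P_pos 1 ltac:(lra)).
  assert (Pm : forall y, 1 <= y -> 1 * Q 1 <= y * Q y) by (intros y Hy; apply P_incr; lra).
  induction k as [|k [C [HC IH]]].
  - exists (/ (1 * Q 1)). split; [now apply Rlt_le, Rinv_0_lt_compat|].
    intros y Hy. simpl pow. apply (Rmult_le_reg_l (1 * Q 1)); auto.
    rewrite <- Rmult_assoc, Rinv_r by lra. specialize (Pm y Hy). lra.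
  - set (C1 := 4 ^ S k * C). set (C2 := 4 ^ S k * / (1 * Q 1)).
    assert (H4 : 0 < 4 ^ S k) by (apply pow_lt; lra).
    assert (HC1 : 0 <= C1) by (apply Rmult_le_pos; lra).
    assert (HC2 : 0 <= C2).
    { apply Rmult_le_pos; [lra|]. now apply Rlt_le, Rinv_0_lt_compat. }
    exists (C1 + C2). split; [lra|]. intros z Hz. assert (Pz := P_pos z ltac:(lra)).
    destruct (Rle_or_lt z 4) as [Hz4|Hz4].
    + apply Rle_trans with (C2 * (z * Q z)); [|nra].
      apply Rle_trans with (4 ^ S k); [apply pow_incr; lra|].
      unfold C2. rewrite Rmult_assoc. rewrite <- (Rmult_1_r (4 ^ S k)) at 1.
      apply Rmult_le_compat_l; [lra|].
      apply (Rmult_le_reg_l (1 * Q 1)); auto.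
      rewrite <- Rmult_assoc, Rinv_r by lra. specialize (Pm z Hz). lra.
    + apply Rle_trans with (C1 * (z * Q z)); [|nra].
      set (y := z / 4). assert (Hzy : z = 4 * y) by (unfold y; field).
      rewrite Hzy, Rpow_mult_distr. unfold C1. rewrite (Rmult_assoc (4 ^ S k)).
      apply Rmult_le_compat_l; [lra|]. assert (Hy : 1 <= y) by lra.
      apply Rle_trans with (C * (y * (y * Q y))).
      * simpl. specialize (IH y Hy). nra.
      * apply Rmult_le_compat_l; auto. apply P_growth. lra.
Qed.

Lemma pow_le_Q (k : nat) : exists C, 0 <= C /\ forall y, 0 <= y -> y ^ k <= C * Q y + 1.
Proof.
  destruct (pow_le_P (S k)) as [C [HC H]]. exists C. split; auto. intros y Hy.
  assert (HQ := Q_pos y Hy). destruct (Rle_or_lt 1 y) as [H1|H1].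
  - assert (y ^ k <= C * Q y); [|lra].
    apply (Rmult_le_reg_l y); [lra|]. specialize (H y H1). simpl in H. nra.
  - assert (y ^ k <= 1); [|nra]. rewrite <- (pow1 k). apply pow_incr. lra.
Qed.

(** * Existence of the moments and expansion at small [s] *)

Lemma int_to_inv : int_to (fun x => 1 / f x) (1 - beta).
Proof.
  replace (1 - beta) with (1 / (1 - 0) - beta) by field.
  apply int_to_ext with (2 := balanced_int_to 0 ltac:(lra)).
  intros x Hx. rewrite Rmult_0_l, f_at_0. reflexivity.
Qed.

Lemma cont0_moment (k : nat) : cont0 (fun x => x ^ k / f x).
Proof. apply cont0_over_f. apply cont0_pow. Qed.

Lemma RInt_Q_half_ub (B : R) : 0 <= B -> RInt (fun x => Q (/ 2 * x) / f x) 0 B <= 2.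
Proof.
  intros HB. assert (K := E_ub B (/ 2) HB ltac:(lra)). unfold E in K.
  rewrite (RInt_ext _ (fun x => / 2 * (Q (/ 2 * x) / f x))) in K
    by (intros x _; eqR; unfold Rdiv; ring).
  rewrite RInt_scal0 in K by (try apply cont0_Q; lra). lra.
Qed.

(** [x ^ k = 2 ^ k * (x / 2) ^ k] is dominated by a combination of [Q (x / 2)] and 1, both
    integrable against [dx / f x]. *)
Lemma moment_exists (k : nat) : exists l, int_to (fun x => x ^ k / f x) l.
Proof.
  destruct (pow_le_Q k) as [C [HC H]].
  apply int_to_bounded with (M := 2 ^ k * (C * 2 + (1 - beta))).
  - apply cont0_moment.
  - intros x Hx. apply Rdiv_le_0_compat; [now apply pow_le | now apply f_pos].
  - intros B HB.
    assert (CQ := cont0_Q (/ 2)).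
    assert (C1 : cont0 (fun x => 1 / f x)) by (apply cont0_over_f, cont0_const).
    apply Rle_trans with
      (RInt (fun x => 2 ^ k * (C * (Q (/ 2 * x) / f x) + 1 / f x)) 0 B).
    + apply RInt_le0; [apply cont0_moment | cont | lra |].
      intros x Hx. assert (Hf := f_pos x ltac:(lra)).
      apply (Rmult_le_reg_r (f x)); auto. unfold Rdiv.
      replace (x ^ k * / f x * f x) with (2 ^ k * (/ 2 * x) ^ k)
        by (rewrite <- Rpow_mult_distr, <- Rmult_assoc, Rinv_r, Rmult_1_l by lra;
            field; lra).
      replace (2 ^ k * (C * (Q (/ 2 * x) * / f x) + 1 * / f x) * f x)
        with (2 ^ k * (C * Q (/ 2 * x) + 1)) by (field; lra).
      apply Rmult_le_compat_l; [apply pow_le; lra|]. apply H. lra.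
    + rewrite RInt_scal0, RInt_plus0, RInt_scal0 by (try lra; cont).
      apply Rmult_le_compat_l; [apply pow_le; lra|].
      apply Rplus_le_compat.
      * apply Rmult_le_compat_l; auto. now apply RInt_Q_half_ub.
      * apply int_to_ub; auto; [|apply int_to_inv].
        intros x Hx. apply Rdiv_le_0_compat; [lra | now apply f_pos].
Qed.

Definition m (k : nat) : R := real (Lim (fun B => RInt (fun x => x ^ k / f x) 0 B) p_infty).

Lemma moment (k : nat) : int_to (fun x => x ^ k / f x) (m k).
Proof.
  destruct (moment_exists k) as [l Hl]. unfold m.
  now rewrite (is_lim_unique _ _ _ Hl).
Qed.

(** On [0, 1] the remainder is [y ^ S K] times a continuous function. Beyond 1 the polynomial is
    [O(y ^ S K)], but [Q] outgrows every power and has to stay in the bound. *)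
Lemma Taylor_remainder (K : nat) : exists C, 0 <= C /\
  (forall y, 0 <= y <= 1 ->
     Rabs (Q y - sum_f_R0 (fun k => average c k * y ^ k) K) <= C * y ^ S K) /\
  (forall y, 1 <= y ->
     Rabs (Q y - sum_f_R0 (fun k => average c k * y ^ k) K) <= C * y ^ S K + Q y).
Proof.
  assert (Hq := average_entire).
  set (r := PS_decr_n (average c) (S K)).
  assert (Hr : entire r).
  { now apply entire_decr_n. }
  destruct (bounded_continuity (V := R_NormedModule) (PSeries r) 0 1) as [C1 HC1].
  { intros x _. apply (ex_derive_continuous (K := R_AbsRing) (V := R_NormedModule)).
    now apply ex_derive_entire. }
  assert (HC1' : 0 <= C1).
  { apply Rle_trans with (Rabs (PSeries r 0)); [apply Rabs_pos|].
    apply Rlt_le, HC1. lra. }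
  assert (HS : exists C2, 0 <= C2 /\ forall y, 1 <= y ->
     Rabs (sum_f_R0 (fun k => average c k * y ^ k) K) <= C2 * y ^ S K).
  { clear. induction K as [|K [C2 [HC2 IH]]].
    - exists (Rabs (average c 0)). split; [apply Rabs_pos|]. intros y Hy. simpl.
      rewrite !Rmult_1_r. assert (H := Rabs_pos (average c 0)). nra.
    - exists (C2 + Rabs (average c (S K))).
      assert (H := Rabs_pos (average c (S K))). split; [lra|]. intros y Hy.
      rewrite tech5. apply Rle_trans with (1 := Rabs_triang _ _).
      specialize (IH y Hy).
      assert (Hy0 : 0 <= y ^ S K) by (apply pow_le; lra).
      assert (Hy1 : y ^ S K <= y ^ S (S K)) by (apply Rle_pow; [lra|lia]).
      rewrite Rabs_mult, (Rabs_pos_eq (y ^ S K)) by auto. nra. }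
  destruct HS as [C2 [HC2 HS]].
  exists (C1 + C2). split; [lra|]. split.
  - intros y Hy. rewrite (PSeries_decr_n (average c) K) by now apply entire_ex.
    fold r. rewrite Rplus_minus_l.
    assert (Hy0 : 0 <= y ^ S K) by (apply pow_le; lra).
    rewrite Rabs_mult, (Rabs_pos_eq (y ^ S K)) by auto.
    assert (K1 := HC1 y Hy). change (norm (PSeries r y)) with (Rabs (PSeries r y)) in K1.
    nra.
  - intros y Hy. assert (HQ := Q_pos y ltac:(lra)). specialize (HS y Hy).
    assert (Hy0 : 0 <= y ^ S K) by (apply pow_le; lra).
    unfold Rminus. apply Rle_trans with (1 := Rabs_triang _ _).
    rewrite Rabs_Ropp, (Rabs_pos_eq (Q y)) by lra. nra.
Qed.

(** The factor [x ^ S K + Q (x / 2)] is independent of [j] and integrable against [dx / f x]. The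
    values of [s] are half powers of [1 / 4] so that [P_growth_iter] leads from [s * x] to
    [4 ^ j * s * x = x / 2]. *)
Lemma scaled_remainder (K : nat) : exists C, 0 <= C /\ forall j x,
  let s := / 2 * / 4 ^ j in 0 <= x ->
  Rabs (Q (s * x) - sum_f_R0 (fun k => average c k * (s * x) ^ k) K)
    <= C * s ^ S K * (x ^ S K + Q (/ 2 * x)).
Proof.
  destruct (Taylor_remainder K) as [C [HC [H0 H1]]].
  (* Passing from [P] to [Q] costs a factor [4 ^ j], hence one power more than the [S K] wanted. *)
  set (A := S (S K)). set (C' := 4 ^ (A * A) * 2 ^ S K).
  assert (HC' : 0 <= C') by (apply Rmult_le_pos; apply pow_le; lra).
  exists (C + C'). split; [lra|]. intros j x s Hx.
  assert (H4 : 0 < 4 ^ j) by (apply pow_lt; lra).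
  assert (Hs : 0 < s).
  { apply Rmult_lt_0_compat; [lra|]. now apply Rinv_0_lt_compat. }
  assert (Hsx : 0 <= s * x) by (apply Rmult_le_pos; lra).
  assert (HQ := Q_pos (/ 2 * x) ltac:(lra)).
  assert (HsK : 0 <= s ^ S K) by (apply pow_le; lra).
  assert (HxK : 0 <= x ^ S K) by (apply pow_le; lra).
  assert (Hprod : 0 <= s ^ S K * x ^ S K) by now apply Rmult_le_pos.
  assert (HprodQ : 0 <= s ^ S K * Q (/ 2 * x)) by (apply Rmult_le_pos; lra).
  destruct (Rle_or_lt 1 (s * x)) as [H|H].
  - apply Rle_trans with (1 := H1 (s * x) H).
    rewrite Rpow_mult_distr.
    assert (G := P_growth_iter A j (s * x) H).
    replace (4 ^ j * (s * x)) with (/ 2 * x) in G by (unfold s; field; lra).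
    assert (L : Q (s * x) <= C' * s ^ S K * Q (/ 2 * x)).
    { apply (Rmult_le_reg_l (4 ^ (A * j) * (s * x))).
      - apply Rmult_lt_0_compat; [apply pow_lt; lra | lra].
      - rewrite Rmult_assoc. apply Rle_trans with (1 := G).
        apply Req_le. unfold C', s, A.
        rewrite !Nat.mul_succ_l, !pow_add, (Nat.mul_comm K j), (pow_mult 4 j K).
        rewrite Rpow_mult_distr. simpl pow. rewrite !pow_inv.
        assert ((4 ^ j) ^ K <> 0) by (apply pow_nonzero; lra).
        assert (2 ^ K <> 0) by (apply pow_nonzero; lra).
        field. repeat split; auto; lra. }
    nra.
  - apply Rle_trans with (1 := H0 (s * x) ltac:(lra)).
    rewrite Rpow_mult_distr. nra.
Qed.

Lemma int_to_Q_div (s : R) :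
  0 < s < 1 -> int_to (fun x => Q (s * x) / f x) (- ln (1 - s) / s - beta).
Proof.
  intros Hs. replace (- ln (1 - s) / s - beta) with (/ s * (- ln (1 - s) - beta * s))
    by (field; lra).
  apply (int_to_ext (fun x => / s * (s * Q (s * x) / f x))).
  - intros x Hx. assert (K := f_neq_0 x ltac:(lra)). field. lra.
  - apply int_to_scal; [apply cont0_E | now apply int_to_Q].
Qed.

(** The pointwise estimate of [scaled_remainder] is integrated against [dx / f x]. *)
Lemma expansion (K : nat) : exists C, 0 <= C /\ forall j, let s := / 2 * / 4 ^ j in
  Rabs (- ln (1 - s) / s - beta - sum_f_R0 (fun k => average c k * s ^ k * m k) K)
    <= C * s ^ S K.
Proof.
  destruct (scaled_remainder K) as [C [HC H]].
  set (I := - ln (1 - / 2) / / 2 - beta).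
  assert (HI : int_to (fun x => Q (/ 2 * x) / f x) I) by (apply int_to_Q_div; lra).
  assert (HI0 : 0 <= I).
  { apply (is_lim_R_lb (fun B => RInt (fun x => Q (/ 2 * x) / f x) 0 B) 0) with (2 := HI).
    intros B HB. apply RInt_ge00; [apply cont0_Q | lra |].
    intros x Hx. apply Rdiv_le_0_compat; [|apply f_pos; lra].
    apply Rlt_le, Q_pos. lra. }
  assert (Hm : 0 <= m (S K)).
  { apply (is_lim_R_lb (fun B => RInt (fun x => x ^ S K / f x) 0 B) 0)
      with (2 := moment (S K)).
    intros B HB. apply RInt_ge00; [apply cont0_moment | lra |].
    intros x Hx. apply Rdiv_le_0_compat; [|apply f_pos; lra]. apply pow_le. lra. }
  exists (C * (m (S K) + I)). split; [apply Rmult_le_pos; lra|]. intros j s.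
  assert (H4 : 1 <= 4 ^ j) by (apply pow_R1_Rle; lra).
  assert (Hs : 0 < s < 1).
  { unfold s. assert (0 < / 4 ^ j) by (apply Rinv_0_lt_compat; lra).
    assert (/ 4 ^ j <= / 1) by (apply Rinv_le_contravar; lra).
    rewrite Rinv_1 in H1. lra. }
  set (g := fun k x => average c k * s ^ k * (x ^ k / f x)).
  assert (Cg : forall k, cont0 (g k)).
  { intros k. apply cont0_mult; [apply cont0_const | apply cont0_moment]. }
  destruct (int_to_sum g (fun k => average c k * s ^ k * m k) K Cg) as [Cs Is].
  { intros k. apply int_to_scal; [apply cont0_moment | apply moment]. }
  set (S0 := sum_f_R0 (fun k => average c k * s ^ k * m k) K) in *.
  assert (CQ := cont0_Q s). assert (CQ2 := cont0_Q (/ 2)).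
  assert (CM := cont0_moment (S K)).
  assert (ID := int_to_lin _ _ (-1) _ _ CQ Cs (int_to_Q_div s Hs) Is).
  assert (CD : cont0 (fun x => Q (s * x) / f x + -1 * sum_f_R0 (fun k => g k x) K)).
  { apply cont0_plus; auto. apply cont0_mult; auto. apply cont0_const. }
  assert (IW := int_to_scal _ (C * s ^ S K) _ (cont0_plus _ _ CM CQ2)
                  (int_to_plus _ _ _ _ CM CQ2 (moment (S K)) HI)).
  assert (CW : forall k, cont0 (fun x => k * (x ^ S K / f x + Q (/ 2 * x) / f x))).
  { intros k. apply cont0_mult; [apply cont0_const | now apply cont0_plus]. }
  assert (Pt : forall x, 0 <= x ->
    Rabs (Q (s * x) / f x + -1 * sum_f_R0 (fun k => g k x) K)
      <= C * s ^ S K * (x ^ S K / f x + Q (/ 2 * x) / f x)).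
  { intros x Hx. assert (Hf := f_pos x Hx). specialize (H j x Hx). fold s in H.
    replace (Q (s * x) / f x + -1 * sum_f_R0 (fun k => g k x) K) with
      ((Q (s * x) - sum_f_R0 (fun k => average c k * (s * x) ^ k) K) * / f x).
    - rewrite Rabs_mult, (Rabs_pos_eq (/ f x)) by (now apply Rlt_le, Rinv_0_lt_compat).
      apply Rle_trans with (C * s ^ S K * (x ^ S K + Q (/ 2 * x)) * / f x).
      + apply Rmult_le_compat_r; auto. now apply Rlt_le, Rinv_0_lt_compat.
      + apply Req_le. unfold Rdiv. ring.
    - assert (Eg : sum_f_R0 (fun k => g k x) K
                   = / f x * sum_f_R0 (fun k => average c k * (s * x) ^ k) K).
      { rewrite scal_sum. apply sum_eq. intros i _. unfold g.
        rewrite Rpow_mult_distr. unfold Rdiv. ring. }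
      rewrite Eg. unfold Rdiv. ring. }
  replace (- ln (1 - s) / s - beta - S0) with (- ln (1 - s) / s - beta + -1 * S0) by ring.
  replace (C * (m (S K) + I) * s ^ S K) with (C * s ^ S K * (m (S K) + I)) by ring.
  apply Rabs_le. split.
  - assert (IN := int_to_scal _ (-1) _ (CW _) IW).
    rewrite <- (Rmult_1_l (_ * _)), Ropp_mult_distr_l.
    refine (int_to_le _ _ _ _ _ CD _ IN ID).
    + apply cont0_mult; [apply cont0_const | apply CW].
    + intros x Hx. assert (K1 := Pt x Hx). apply Rabs_le_between in K1. lra.
  - refine (int_to_le _ _ _ _ CD (CW _) _ ID IW).
    intros x Hx. assert (K1 := Pt x Hx). apply Rabs_le_between in K1. lra.
Qed.

Definition mass (k : nat) : R := match k with O => 1 - beta | S _ => 1 end.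

(** Uniqueness of asymptotic expansions: [expansion] and the Taylor formula for the logarithm
    describe the same function of [s] up to [O(s ^ S K)], and by strong induction the terms below
    [K] cancel. *)
Lemma coefficient_moment (K : nat) : c K * m K = mass K.
Proof.
  induction K as [K IH] using Wf_nat.lt_wf_ind.
  destruct (expansion K) as [C [HC H]].
  set (d := (mass K - c K * m K) / INR (S K)).
  assert (HK : INR (S K) <> 0) by (apply not_0_INR; lia).
  (* The difference of the coefficients of [s ^ K] is [O(s)] along a sequence of [s] tending to
     0. *)
  assert (Hd : forall j, Rabs d <= (C + 2) * (/ 2 * / 4 ^ j)).
  { intros j. set (s := / 2 * / 4 ^ j).
    assert (H4 : 1 <= 4 ^ j) by (apply pow_R1_Rle; lra).
    assert (Hs : 0 < s <= / 2).
    { unfold s. assert (0 < / 4 ^ j) by (apply Rinv_0_lt_compat; lra).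
      assert (/ 4 ^ j <= / 1) by (apply Rinv_le_contravar; lra).
      rewrite Rinv_1 in H1. lra. }
    assert (HsK : 0 < s ^ K) by (apply pow_lt; lra).
    assert (E1 := H j). cbv zeta in E1. fold s in E1.
    assert (E2 := neg_ln_Taylor K s Hs).
    assert (E3 : sum_f_R0 (fun k => s ^ k / INR (S k)) K - beta
                 - sum_f_R0 (fun k => average c k * s ^ k * m k) K = d * s ^ K).
    { assert (G : forall n, sum_f_R0 (fun k => s ^ k / INR (S k)) n - beta
                 - sum_f_R0 (fun k => average c k * s ^ k * m k) n
                 = sum_f_R0 (fun k => (mass k - c k * m k) / INR (S k) * s ^ k) n).
      { induction n as [|n IHn].
        - simpl. unfold average. simpl. field.
        - rewrite !tech5, <- IHn. unfold average, mass.
          assert (INR (S (S n)) <> 0) by (apply not_0_INR; lia). field. auto. }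
      rewrite G. destruct K as [|K]; [reflexivity|].
      rewrite tech5, (sum_eq _ (fun _ => 0)).
      - rewrite sum_cte. unfold d. ring.
      - intros i Hi. rewrite IH by lia. unfold Rdiv. ring. }
    apply (Rmult_le_reg_r (s ^ K)); auto.
    rewrite <- (Rabs_pos_eq (s ^ K)) at 1 by lra. rewrite <- Rabs_mult, <- E3.
    change (s ^ S K) with (s * s ^ K) in E1, E2.
    apply Rabs_le_between in E1. apply Rabs_le_between in E2.
    apply Rabs_le. lra. }
  assert (D0 : d = 0).
  { destruct (Req_dec d 0) as [|Hn]; auto. exfalso.
    assert (Hp := Rabs_pos_lt d Hn).
    destruct (pow_lt_1_zero (/ 4)) with (y := Rabs d / (C + 2)) as [N HN].
    - rewrite Rabs_pos_eq; lra.
    - apply Rdiv_lt_0_compat; lra.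
    - specialize (HN N (le_n N)). specialize (Hd N).
      rewrite pow_inv, Rabs_pos_eq in HN
        by (apply Rlt_le, Rinv_0_lt_compat, pow_lt; lra).
      apply (Rmult_lt_compat_l (C + 2)) in HN; [|lra].
      replace ((C + 2) * (Rabs d / (C + 2))) with (Rabs d) in HN by (field; lra).
      assert (0 < / 4 ^ N) by (apply Rinv_0_lt_compat, pow_lt; lra). nra. }
  unfold d in D0. apply (Rmult_eq_compat_r (INR (S K))) in D0.
  unfold Rdiv in D0. rewrite Rmult_assoc, Rinv_l, Rmult_0_l in D0 by auto. lra.
Qed.

(** * Exponential growth of the solution *)

Lemma mass_bounds (k : nat) : 0 < mass k <= 1.
Proof. destruct k; simpl; lra. Qed.

Lemma m_nonneg (k : nat) : 0 <= m k.
Proof.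
  apply (is_lim_R_lb (fun B => RInt (fun x => x ^ k / f x) 0 B) 0) with (2 := moment k).
  intros B HB. apply RInt_ge00; [apply cont0_moment | lra |].
  intros x Hx. apply Rdiv_le_0_compat; [|apply f_pos; lra]. apply pow_le. lra.
Qed.

(** [c k * m k] is a positive mass and [m k] is nonnegative as an integral, so both factors are
    positive. *)
Lemma c_pos (k : nat) : 0 < c k.
Proof.
  assert (H := coefficient_moment k). assert (M := mass_bounds k).
  assert (P := m_nonneg k). nra.
Qed.

Lemma m_pos (k : nat) : 0 < m k.
Proof.
  assert (H := coefficient_moment k). assert (M := mass_bounds k).
  destruct (m_nonneg k) as [|E0]; auto.
  rewrite <- E0, Rmult_0_r in H. lra.
Qed.

Lemma moment_S (k : nat) : m (S k) = / c (S k).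
Proof.
  assert (H := coefficient_moment (S k)). assert (P := c_pos (S k)).
  apply (Rmult_eq_reg_l (c (S k))); [|lra]. rewrite H, Rinv_r; [reflexivity | lra].
Qed.

Notation f1 := (PSeries (euler c)).
Notation N := (fun x => PSeries (euler c) x / PSeries c x).

Lemma euler_entire : entire (euler c).
Proof. now apply entire_euler. Qed.

Lemma cont0_N : cont0 N.
Proof. apply cont0_over_f. apply cont0_entire1, euler_entire. Qed.

Lemma int_to_term (k : nat) : int_to (fun x => c k * (x ^ k / f x)) (mass k).
Proof.
  rewrite <- coefficient_moment. apply int_to_scal; [apply cont0_moment | apply moment].
Qed.

Lemma cont0_term (k : nat) : cont0 (fun x => c k * (x ^ k / f x)).
Proof. apply cont0_mult; [apply cont0_const | apply cont0_moment]. Qed.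

Lemma term_pos (k : nat) (x : R) : 0 <= x -> 0 <= c k * (x ^ k / f x).
Proof.
  intros Hx. apply Rmult_le_pos; [apply Rlt_le, c_pos|].
  apply Rdiv_le_0_compat; [now apply pow_le | now apply f_pos].
Qed.

Lemma f_ge_term (k : nat) (x : R) : 0 <= x -> c k * x ^ k <= f x.
Proof.
  intros Hx. destruct k as [|k].
  - apply (partial_sum_le c 0 x Hx); auto. intros k _. apply Rlt_le, c_pos.
  - apply Rle_trans with (sum_f_R0 (fun k => c k * x ^ k) (S k)).
    + rewrite tech5.
      assert (0 <= sum_f_R0 (fun k => c k * x ^ k) k); [|lra].
      apply cond_pos_sum. intros i. apply Rmult_le_pos; [apply Rlt_le, c_pos|].
      now apply pow_le.
    + apply partial_sum_le; auto. intros i _. apply Rlt_le, c_pos.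
Qed.

(** * Factorial upper bound on the coefficients *)

(** The integral of [x] against the density [c k * x ^ k / f x], because [m (S k) = / c (S k)]. *)
Definition rho (k : nat) : R := c k / c (S k).

Lemma rho_pos (k : nat) : 0 < rho k.
Proof. apply Rdiv_lt_0_compat; apply c_pos. Qed.

(** The integral of [x ^ k * (x - l) ^ 2 / f x] is nonnegative; [l = m (S k) / m k] minimises it. *)
Lemma moment_Cauchy_Schwarz (k : nat) : m (S k) * m (S k) <= m k * m (S (S k)).
Proof.
  set (l := m (S k) / m k). assert (Hm := m_pos k).
  assert (C0 := cont0_moment k). assert (C1 := cont0_moment (S k)).
  assert (C2 := cont0_moment (S (S k))).
  assert (I1 := int_to_lin _ _ (- (2 * l)) _ _ C2 C1 (moment (S (S k))) (moment (S k))).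
  assert (C3 : cont0 (fun x => x ^ S (S k) / f x + - (2 * l) * (x ^ S k / f x))).
  { apply cont0_plus; auto. apply cont0_mult; auto. apply cont0_const. }
  assert (I2 := int_to_lin _ _ (l * l) _ _ C3 C0 I1 (moment k)).
  assert (H : 0 <= m (S (S k)) + - (2 * l) * m (S k) + l * l * m k).
  { apply (is_lim_R_lb _ 0 _ 0) with (2 := I2). intros B HB.
    apply RInt_ge00; [|lra|].
    - apply cont0_plus; auto. apply cont0_mult; auto. apply cont0_const.
    - intros x Hx. assert (Hf := f_pos x ltac:(lra)).
      replace (x ^ S (S k) / f x + - (2 * l) * (x ^ S k / f x) + l * l * (x ^ k / f x))
        with (x ^ k * (x - l) ^ 2 / f x) by (simpl; field; lra).
      apply Rdiv_le_0_compat; auto. apply Rmult_le_pos; [apply pow_le; lra|].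
      apply pow2_ge_0. }
  replace (m (S (S k)) + - (2 * l) * m (S k) + l * l * m k)
    with ((m k * m (S (S k)) - m (S k) * m (S k)) / m k) in H by (unfold l; field; lra).
  apply (Rmult_le_compat_r (m k)) in H; [|lra].
  unfold Rdiv in H. rewrite Rmult_assoc, Rinv_l in H by lra. lra.
Qed.

(** Log-convexity of the moments. At [k = 0] the missing mass is harmless, since [m 0 <= / c 0] is
    the direction needed. *)
Lemma rho_incr (k : nat) : rho k <= rho (S k).
Proof.
  assert (H := moment_Cauchy_Schwarz k). rewrite !moment_S in H.
  assert (E1 := coefficient_moment k). assert (M := mass_bounds k).
  assert (P0 := c_pos k). assert (P1 := c_pos (S k)). assert (P2 := c_pos (S (S k))).
  assert (H' : / c (S k) * / c (S k) <= / c k * / c (S (S k))).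
  { apply Rle_trans with (1 := H). apply Rmult_le_compat_r.
    - now apply Rlt_le, Rinv_0_lt_compat.
    - apply (Rmult_le_reg_l (c k)); auto. rewrite Rinv_r; lra. }
  unfold rho. apply (Rmult_le_compat_l (c k * c (S k))) in H'; [|nra].
  replace (c k / c (S k)) with (c k * c (S k) * (/ c (S k) * / c (S k))) by (field; lra).
  replace (c (S k) / c (S (S k))) with (c k * c (S k) * (/ c k * / c (S (S k))))
    by (field; lra).
  exact H'.
Qed.

(* [T <= 1] has integral [nu], hence first moment at least that of the indicator of
   [0, nu]. *)
Lemma sum_rho_ge (n : nat) :
  (INR (S n) - beta) * (INR (S n) - beta) / 2 <= sum_f_R0 rho n.
Proof.
  set (nu := INR (S n) - beta).
  assert (Hnu : 0 < nu).
  { unfold nu. rewrite S_INR. assert (K := pos_INR n). lra. }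
  set (T := fun x => sum_f_R0 (fun k => c k * (x ^ k / f x)) n).
  destruct (int_to_sum _ _ n cont0_term int_to_term) as [CT IT].
  assert (Hmass : sum_f_R0 mass n = nu).
  { unfold nu. clear. induction n as [|n IH].
    - simpl. lra.
    - rewrite tech5, IH, (S_INR (S n)). simpl mass. lra. }
  rewrite Hmass in IT.
  assert (HT : forall x, 0 <= x -> 0 <= T x <= 1).
  { intros x Hx. split.
    - apply cond_pos_sum. intros k. now apply term_pos.
    - unfold T. assert (Hf := f_pos x Hx).
      rewrite (sum_eq _ (fun k => c k * x ^ k * / f x))
        by (intros; unfold Rdiv; ring).
      rewrite <- scal_sum. apply (Rmult_le_reg_l (f x)); auto.
      rewrite <- Rmult_assoc, Rinv_r, Rmult_1_l, Rmult_1_r by lra.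
      apply partial_sum_le; auto. intros k _. apply Rlt_le, c_pos. }
  assert (CxT : cont0 (fun x => x * T x)) by (apply cont0_mult; auto; apply cont0_id).
  assert (IxT : int_to (fun x => x * T x) (sum_f_R0 rho n)).
  { set (g := fun k x => c k * (x ^ S k / f x)).
    assert (Cg : forall k, cont0 (g k)).
    { intros k. apply cont0_mult; [apply cont0_const | apply cont0_moment]. }
    destruct (int_to_sum g rho n Cg) as [_ Ig].
    - intros k. unfold rho, Rdiv. rewrite <- moment_S.
      apply int_to_scal; [apply cont0_moment | apply moment].
    - apply int_to_ext with (2 := Ig). intros x Hx. unfold T. rewrite scal_sum.
      apply sum_eq. intros k _. unfold g. simpl. unfold Rdiv. ring. }
  assert (IL := int_to_lin _ _ (- nu) _ _ CxT CT IxT IT).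
  assert (C3 : cont0 (fun x => x * T x + - nu * T x)).
  { apply cont0_plus; auto. apply cont0_mult; auto. apply cont0_const. }
  (* [(x - nu) * T x] is at least [x - nu] on [0, nu], where [T x <= 1], and nonnegative beyond. *)
  assert (H : - (nu * nu / 2) <= sum_f_R0 rho n + - nu * nu).
  { apply (is_lim_R_lb _ nu _ _) with (2 := IL). intros B HB.
    rewrite <- (RInt_Chasles0 _ 0 nu B) by (auto; lra).
    assert (0 <= RInt (fun x => x * T x + - nu * T x) nu B).
    { apply RInt_ge00; auto; [lra|]. intros x Hx.
      assert (K := HT x ltac:(lra)). nra. }
    assert (RInt (fun x => x - nu) 0 nu <= RInt (fun x => x * T x + - nu * T x) 0 nu).
    { apply RInt_le0; auto; [cont | lra |]. intros x Hx.
      assert (K := HT x ltac:(lra)). nra. }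
    rewrite (RInt_primitive (fun x => x * x / 2 - nu * x)) in H0.
    - unfold T in *. lra.
    - intros x _. auto_derive; auto. field.
    - intros x _. apply (ex_derive_continuous (K := R_AbsRing) (V := R_NormedModule)).
      auto_derive. auto. }
  lra.
Qed.

(* Its partial sums are at most [(INR (S n) - beta) ^ 2 / 2]. *)
Definition base (k : nat) : R :=
  match k with O => (1 - beta) * (1 - beta) / 2 | S _ => INR k - / 2 end.

Lemma base_pos (k : nat) : 0 < base k.
Proof.
  destruct k as [|k]; unfold base.
  - nra.
  - rewrite S_INR. assert (K := pos_INR k). lra.
Qed.

Lemma sum_base_le (n : nat) : sum_f_R0 base n <= sum_f_R0 rho n.
Proof.
  apply Rle_trans with (2 := sum_rho_ge n).
  assert (E1 : sum_f_R0 base n = (1 - beta) * (1 - beta) / 2 + INR n * INR n / 2).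
  { induction n as [|n IH].
    - simpl. field.
    - rewrite tech5, IH. unfold base. rewrite S_INR. field. }
  rewrite E1, S_INR. assert (K := pos_INR n). nra.
Qed.

Lemma sum_ln_rho (n : nat) : sum_f_R0 (fun k => ln (rho k)) n = - ln (c (S n)).
Proof.
  induction n as [|n IH].
  - simpl. unfold rho. rewrite ln_div by apply c_pos. rewrite c_0, ln_1. ring.
  - rewrite tech5, IH. unfold rho. rewrite ln_div by apply c_pos. ring.
Qed.

(** [- ln (c (S n))] is the sum of the [ln (rho k)], and [sum_ln_le] bounds it below by that of the
    [ln (base k)]. The crude factor [INR (S n) ^ 2] compensates for the [- 1 / 2] in [base]: the
    induction uses [(n + 1) ^ 2 <= (n + 1 / 2) * (n + 2)]. *)
Lemma c_ub_S (n : nat) :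
  c (S n) <= / base 0 * (INR (S n) * INR (S n) * / INR (Factorial.fact (S n))).
Proof.
  assert (B0 := base_pos 0).
  assert (H : - ln (c (S n)) >= sum_f_R0 (fun k => ln (base k)) n).
  { rewrite <- sum_ln_rho. apply Rle_ge. apply sum_ln_le.
    - apply base_pos.
    - intros k. split; [apply rho_pos | apply rho_incr].
    - apply sum_base_le. }
  assert (P : 0 < INR (S n) * INR (S n) * / INR (Factorial.fact (S n))).
  { assert (0 < INR (S n)) by (apply lt_0_INR; lia).
    apply Rmult_lt_0_compat; [nra|]. apply Rinv_0_lt_compat, INR_fact_lt_0. }
  assert (G : - ln (/ base 0 * (INR (S n) * INR (S n) * / INR (Factorial.fact (S n))))
              <= sum_f_R0 (fun k => ln (base k)) n).
  { clear H P. induction n as [|n IH].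
    - change (sum_f_R0 (fun k => ln (base k)) 0) with (ln (base 0)).
      change (INR (Factorial.fact 1)) with 1. change (INR 1) with 1.
      rewrite Rinv_1, !Rmult_1_r, ln_Rinv by auto. lra.
    - rewrite tech5. assert (B1 := base_pos (S n)). assert (Hn := pos_INR n).
      assert (F := INR_fact_lt_0 (S n)).
      assert (Hn1 : 0 < INR (S n)) by (apply lt_0_INR; lia).
      assert (L : ln (/ base 0 * (INR (S n) * INR (S n) * / INR (Factorial.fact (S n))))
                  <= ln (base (S n) * (/ base 0 * (INR (S (S n)) * INR (S (S n))
                         * / INR (Factorial.fact (S (S n))))))).
      { apply ln_le.
        - repeat apply Rmult_lt_0_compat; auto; now apply Rinv_0_lt_compat.
        - rewrite (fact_simpl (S n)), mult_INR.
          apply (Rmult_le_reg_r (base 0 * INR (Factorial.fact (S n)))); [nra|].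
          replace (/ base 0 * (INR (S n) * INR (S n) * / INR (Factorial.fact (S n)))
                   * (base 0 * INR (Factorial.fact (S n))))
            with (INR (S n) * INR (S n)) by (field; lra).
          assert (0 < INR (S (S n))) by (apply lt_0_INR; lia).
          replace (base (S n) * (/ base 0 * (INR (S (S n)) * INR (S (S n))
                    * / (INR (S (S n)) * INR (Factorial.fact (S n)))))
                   * (base 0 * INR (Factorial.fact (S n))))
            with (base (S n) * INR (S (S n))) by (field; lra).
          change (base (S n)) with (INR (S n) - / 2). rewrite !S_INR. nra. }
      rewrite (ln_mult (base (S n))) in L; auto; [lra|].
      repeat apply Rmult_lt_0_compat; try (now apply Rinv_0_lt_compat);
        try (apply lt_0_INR; lia).
      apply Rinv_0_lt_compat, INR_fact_lt_0. }
  assert (Hc := c_pos (S n)).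
  apply Rnot_lt_le. intros Hlt.
  apply ln_increasing in Hlt.
  - lra.
  - apply Rmult_lt_0_compat; auto. now apply Rinv_0_lt_compat.
Qed.

(** The polynomial factor of [c_ub_S] is absorbed in [(1 + eta) ^ n], and the resulting bound on the
    coefficients sums to an exponential. *)
Lemma ln_f_ub (eta : R) :
  0 < eta <= 1 -> exists C, forall x, 0 <= x -> ln (f x) <= (1 + eta) * x + C.
Proof.
  intros He. destruct (square_le_geometric eta He) as [C [HC HG]].
  assert (B0 := base_pos 0). assert (Hi := Rinv_0_lt_compat _ B0).
  set (C1 := / base 0 * C + 1).
  assert (HC1 : 0 < C1) by (unfold C1; nra).
  assert (Hc : forall n, c n <= C1 * ((1 + eta) ^ n * / INR (Factorial.fact n))).
  { intros n. assert (F := Rinv_0_lt_compat _ (INR_fact_lt_0 n)).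
    assert (Hp : 0 < (1 + eta) ^ n) by (apply pow_lt; lra).
    destruct n as [|n].
    - rewrite c_0. simpl. unfold C1. rewrite Rinv_1. nra.
    - apply Rle_trans with (1 := c_ub_S n). unfold C1.
      assert (K := HG (S n)).
      apply Rle_trans with
        (/ base 0 * (C * (1 + eta) ^ S n * / INR (Factorial.fact (S n)))).
      + apply Rmult_le_compat_l; [lra|]. apply Rmult_le_compat_r; lra.
      + assert (0 < (1 + eta) ^ S n * / INR (Factorial.fact (S n)))
          by now apply Rmult_lt_0_compat.
        nra. }
  exists (ln C1). intros x Hx.
  destruct (PSeries_exp C1 (1 + eta) x) as [HE HS].
  assert (H : f x <= C1 * exp ((1 + eta) * x)).
  { rewrite <- HS. apply PSeries_le; auto. }
  apply ln_le in H; [|now apply f_pos].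
  rewrite ln_mult, ln_exp in H; auto; [lra | apply exp_pos].
Qed.

(** * Lower bound on [ln f] and asymptotics of the conditional mean *)

(** [N x - M] is the mean of [k - M] under the weights [c k * x ^ k / f x]; dropping the indices
    above [M] lowers it. *)
Lemma N_ge (M : nat) (x : R) : 0 <= x ->
  INR M - sum_f_R0 (fun k => (INR M - INR k) * (c k * (x ^ k / f x))) M <= N x.
Proof.
  intros Hx. assert (Hf := f_pos x Hx).
  assert (K : sum_f_R0 (fun k => (euler c k + - INR M * c k) * x ^ k) M
              <= f1 x + - INR M * f x).
  { rewrite <- PSeries_lin by (auto; apply euler_entire).
    apply partial_sum_le; auto.
    - apply entire_lin; auto. apply euler_entire.
    - intros k Hk. unfold euler. apply lt_INR in Hk. assert (P := c_pos k). nra. }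
  assert (E1 : sum_f_R0 (fun k => (INR M - INR k) * (c k * (x ^ k / f x))) M
               = - / f x * sum_f_R0 (fun k => (euler c k + - INR M * c k) * x ^ k) M).
  { rewrite scal_sum. apply sum_eq. intros k _. unfold euler, Rdiv. ring. }
  rewrite E1. apply (Rmult_le_reg_r (f x)); auto.
  replace (f1 x / f x * f x) with (f1 x) by (field; lra).
  rewrite Rmult_minus_distr_r.
  replace (- / f x * sum_f_R0 (fun k => (euler c k + - INR M * c k) * x ^ k) M * f x)
    with (- sum_f_R0 (fun k => (euler c k + - INR M * c k) * x ^ k) M) by (field; lra).
  lra.
Qed.

(** [N_ge] is integrated with [M] the integer part of [X]. Each density has mass at most 1, so the
    loss is at most the sum of the [M - k], that is [M * (M + 1) / 2]. *)
Lemma RInt_N_ge (X : R) : 0 <= X -> X * X / 2 - X <= RInt N 0 X.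
Proof.
  intros HX. destruct (nfloor_ex X HX) as [M HM].
  set (g := fun k x => (INR M - INR k) * (c k * (x ^ k / f x))).
  assert (Cg : forall k, cont0 (g k)).
  { intros k. apply cont0_mult; [apply cont0_const | apply cont0_term]. }
  assert (G : forall n, (n <= M)%nat ->
     cont0 (fun x => sum_f_R0 (fun k => g k x) n) /\
     RInt (fun x => sum_f_R0 (fun k => g k x) n) 0 X
       <= sum_f_R0 (fun k => INR M - INR k) n).
  { assert (Hk : forall k, (k <= M)%nat -> RInt (g k) 0 X <= INR M - INR k).
    { intros k Hk. apply le_INR in Hk. unfold g.
      rewrite (RInt_scal0 (fun x => c k * (x ^ k / f x))) by (try apply cont0_term; lra).
      assert (U : RInt (fun x => c k * (x ^ k / f x)) 0 X <= mass k).
      { apply int_to_ub; auto; [apply cont0_term | apply term_pos | apply int_to_term]. }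
      assert (K := mass_bounds k). nra. }
    induction n as [|n IH]; intros Hn.
    - split; [apply (Cg 0%nat) | now apply (Hk 0%nat)].
    - destruct (IH ltac:(lia)) as [IC IR]. split.
      + exact (cont0_plus _ _ IC (Cg (S n))).
      + assert (E1 := RInt_plus0 _ _ 0 X IC (Cg (S n)) ltac:(lra) HX).
        assert (K := Hk (S n) Hn).
        rewrite tech5. apply Rle_trans with (1 := Req_le _ _ E1). lra. }
  destruct (G M (le_n M)) as [CG HG].
  assert (E1 : sum_f_R0 (fun k => INR M - INR k) M = INR M * (INR M + 1) / 2).
  { rewrite (minus_sum (fun _ => INR M) INR M), sum_cte, sum_INR, S_INR. field. }
  rewrite E1 in HG.
  assert (H : RInt (fun x => INR M - sum_f_R0 (fun k => g k x) M) 0 X <= RInt N 0 X).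
  { apply RInt_le0; try lra; try apply cont0_N.
    - apply cont0_minus; auto. apply cont0_const.
    - intros x Hx. apply N_ge. lra. }
  rewrite (RInt_ext _ (fun x => INR M + -1 * sum_f_R0 (fun k => g k x) M)) in H
    by (intros; eqR; ring).
  rewrite (RInt_plus0 (fun _ => INR M) (fun x => -1 * sum_f_R0 (fun k => g k x) M)) in H;
    try lra; try apply cont0_const; [|apply cont0_mult; auto; apply cont0_const].
  rewrite (RInt_scal0 (fun x => sum_f_R0 (fun k => g k x) M)) in H by (auto; lra).
  rewrite RInt_const_R in H. assert (K := pos_INR M). nra.
Qed.

Lemma is_derive_ln_f (x : R) : 0 < x -> is_derive (fun x => ln (f x)) x (N x / x).
Proof.
  intros Hx. assert (Hf := f_pos x ltac:(lra)). auto_derive.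
  - split; auto. now apply ex_derive_entire.
  - rewrite Derive_entire, PSeries_euler by auto. field. lra.
Qed.

(** Integration by parts of [N x / x]: with [A >= 0] the excess in [RInt_N_ge], the derivative of
    [G] is [A x / x ^ 2], so [G] increases, and [A X / X] may be dropped. *)
Lemma ln_f_lb : exists C, forall X, 1 <= X -> X - ln X - C <= ln (f X).
Proof.
  set (A := fun X => RInt N 0 X - (X * X / 2 - X)).
  set (G := fun X => ln (f X) + (ln X - X - A X / X)).
  exists (- G 1). intros X HX.
  assert (Hd : forall x, 1 <= x <= X -> is_derive G x (A x / (x * x))).
  { intros x Hx.
    replace (A x / (x * x)) with
      (N x / x + (/ x - 1 - ((N x - (x - 1)) / x - A x / (x * x)))).
    2:{ assert (Hf := f_neq_0 x ltac:(lra)). field. split; lra. }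
    apply (is_derive_plus (K := R_AbsRing) (V := R_NormedModule)
             (fun x => ln (f x)) (fun x => ln x - x - A x / x));
      [apply is_derive_ln_f; lra|].
    assert (DA : is_derive A x (N x - (x - 1))).
    { apply (is_derive_minus (K := R_AbsRing) (V := R_NormedModule)
               (fun X => RInt N 0 X) (fun X => X * X / 2 - X)).
      - apply (is_derive_RInt0 N); [apply cont0_N | lra].
      - auto_derive; auto. field. }
    assert (EA : Derive (fun x => A x) x = N x - (x - 1)) by now apply is_derive_unique.
    auto_derive.
    - repeat split; try lra. eexists. exact DA.
    - rewrite EA. assert (Hf := f_neq_0 x ltac:(lra)). field. split; lra. }
  assert (HA : forall x, 0 <= x -> 0 <= A x).
  { intros x Hx. unfold A. assert (K := RInt_N_ge x Hx). lra. }
  assert (K : G 1 <= G X).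
  { apply derive_nonneg_incr with (2 := Hd); auto. intros x Hx.
    apply Rdiv_le_0_compat; [apply HA; lra | nra]. }
  assert (0 <= A X / X) by (apply Rdiv_le_0_compat; [apply HA|]; lra).
  unfold G at 2 in K. lra.
Qed.

(** The derivative of [N] with respect to [ln x] is the variance of the index given [x]. *)
Lemma N_incr (x y : R) : 0 < x <= y -> N x <= N y.
Proof.
  intros H. set (f2 := PSeries (euler (euler c))).
  assert (He := euler_entire). assert (He2 := entire_euler _ He).
  apply (derive_nonneg_incr N (fun x => (f2 x * f x - f1 x * f1 x) / (x * (f x * f x))));
    [lra| |].
  - intros z Hz. assert (Hf := f_pos z ltac:(lra)). auto_derive.
    + repeat split; try lra; now apply ex_derive_entire.
    + rewrite !Derive_entire by auto. unfold f2.
      rewrite (PSeries_euler (euler c)), (PSeries_euler c). field. lra.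
  - intros z Hz. assert (Hf := f_pos z ltac:(lra)).
    apply Rdiv_le_0_compat; [|apply Rmult_lt_0_compat; nra].
    set (l := f1 z / f z).
    assert (K : 0 <= PSeries (fun n => (euler (euler c) n + - (2 * l) * euler c n)
                                       + l * l * c n) z).
    { apply PSeries_nonneg; [lra| |].
      - repeat apply entire_lin; auto.
      - intros n. unfold euler. assert (P := c_pos n).
        replace (INR n * (INR n * c n) + - (2 * l) * (INR n * c n) + l * l * c n)
          with (c n * (INR n - l) ^ 2) by ring.
        apply Rmult_le_pos; [lra | apply pow2_ge_0]. }
    rewrite (PSeries_lin (fun n => euler (euler c) n + - (2 * l) * euler c n)) in K;
      auto; [|now apply entire_lin].
    rewrite PSeries_lin in K by auto. fold f2 in K.
    replace (f2 z + - (2 * l) * f1 z + l * l * f z)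
      with ((f2 z * f z - f1 z * f1 z) / f z) in K by (unfold l; field; lra).
    apply (Rmult_le_compat_r (f z)) in K; [|lra].
    unfold Rdiv in K. rewrite Rmult_assoc, Rinv_l in K by lra. lra.
Qed.

Lemma ln_f_mean_value (x y : R) : 0 < x <= y ->
  exists xi, x <= xi <= y /\ ln (f y) - ln (f x) = N xi / xi * (y - x).
Proof.
  intros H. destruct (MVT_gen (fun x => ln (f x)) x y (fun x => N x / x))
    as [xi [Hxi K]]; rewrite Rmin_left, Rmax_right in * by lra.
  - intros z Hz. apply is_derive_ln_f. lra.
  - intros z Hz. apply continuity_pt_ex_derive. eexists. apply is_derive_ln_f. lra.
  - now exists xi.
Qed.

Lemma ln_f_bounds (eta : R) : 0 < eta <= 1 -> exists C, 0 <= C /\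
  (forall x, 0 <= x -> ln (f x) <= (1 + eta) * x + C) /\
  (forall x, 1 <= x -> (1 - eta) * x - C <= ln (f x)).
Proof.
  intros He. destruct (ln_f_ub eta He) as [C1 H1]. destruct ln_f_lb as [C2 H2].
  destruct (ln_le_linear eta ltac:(lra)) as [C3 H3].
  exists (Rabs C1 + Rabs C2 + Rabs C3).
  assert (A1 := Rle_abs C1). assert (A2 := Rle_abs C2). assert (A3 := Rle_abs C3).
  assert (P1 := Rabs_pos C1). assert (P2 := Rabs_pos C2). assert (P3 := Rabs_pos C3).
  repeat split; [lra| |]; intros x Hx.
  - specialize (H1 x Hx). lra.
  - specialize (H2 x Hx). specialize (H3 x ltac:(lra)). lra.
Qed.

(** As [N] increases, it is compared with the increments of [ln f] between [x] and [(1 - d) * x] or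
    [(1 + d) * x]. Taking the error of [ln_f_bounds] as [d ^ 2] leaves a relative error of order [d]
    after division by [d], and the factors are exactly the cubes. *)
Lemma N_asymptotic (d : R) : 0 < d < 1 -> exists C, forall x, 1 <= x ->
  (1 - d) ^ 3 * x - C <= N x <= (1 + d) ^ 3 * x + C.
Proof.
  intros Hd. destruct (ln_f_bounds (d * d) ltac:(nra)) as [C [HC [HU HL]]].
  exists (4 * C / d). intros x Hx. split.
  - destruct (ln_f_mean_value ((1 - d) * x) x) as [xi [Hxi E1]].
    { split; [apply Rmult_lt_0_compat; lra | nra]. }
    assert (Hx0 : 0 < (1 - d) * x) by (apply Rmult_lt_0_compat; lra).
    assert (K1 := HL x Hx). assert (K2 := HU ((1 - d) * x) ltac:(lra)).
    assert (Nx := N_incr xi x ltac:(lra)).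
    assert (G : (1 - d) * (ln (f x) - ln (f ((1 - d) * x))) <= d * N x).
    { rewrite E1.
      assert (Nxi : 0 <= N xi).
      { apply Rdiv_le_0_compat; [|apply f_pos; lra]. apply PSeries_nonneg; [lra| |].
        - apply euler_entire.
        - intros n. apply Rmult_le_pos; [apply pos_INR | apply Rlt_le, c_pos]. }
      replace ((1 - d) * (N xi / xi * (x - (1 - d) * x)))
        with (d * (N xi * ((1 - d) * x / xi)))
        by (assert (Hf := f_neq_0 xi ltac:(lra)); field; split; lra).
      apply Rmult_le_compat_l; [lra|].
      apply Rle_trans with (N xi * 1); [|lra]. apply Rmult_le_compat_l; auto.
      apply Rle_div_l; lra. }
    apply (Rmult_le_reg_l d); [lra|]. apply Rle_trans with (2 := G).
    replace (d * ((1 - d) ^ 3 * x - 4 * C / d)) with (d * (1 - d) ^ 3 * x - 4 * C)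
      by (field; lra).
    nra.
  - destruct (ln_f_mean_value x ((1 + d) * x)) as [xi [Hxi E1]]; [nra|].
    assert (K1 := HL x Hx). assert (K2 := HU ((1 + d) * x) ltac:(nra)).
    assert (Nx := N_incr x xi ltac:(lra)).
    assert (G : d * N x <= (1 + d) * (ln (f ((1 + d) * x)) - ln (f x))).
    { rewrite E1.
      assert (Nxi : 0 <= N xi).
      { apply Rdiv_le_0_compat; [|apply f_pos; lra]. apply PSeries_nonneg; [lra| |].
        - apply euler_entire.
        - intros n. apply Rmult_le_pos; [apply pos_INR | apply Rlt_le, c_pos]. }
      replace ((1 + d) * (N xi / xi * ((1 + d) * x - x)))
        with (d * (N xi * ((1 + d) * x / xi)))
        by (assert (Hf := f_neq_0 xi ltac:(lra)); field; split; lra).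
      apply Rmult_le_compat_l; [lra|].
      apply Rle_trans with (1 := Nx).
      apply Rle_trans with (N xi * 1); [lra|]. apply Rmult_le_compat_l; auto.
      apply Rle_div_r; lra. }
    apply (Rmult_le_reg_l d); [lra|]. apply Rle_trans with (1 := G).
    replace (d * ((1 + d) ^ 3 * x + 4 * C / d)) with (d * (1 + d) ^ 3 * x + 4 * C)
      by (field; lra).
    nra.
Qed.

(** * The maximum principle *)

(** The derivative of [x ^ S k / f x] is [(INR (S k) - N x) * x ^ k / f x]. The boundary term
    vanishes at infinity because [f x >= c (S (S k)) * x ^ S (S k)]. *)
Lemma by_parts (k : nat) :
  int_to (fun x => N x * (x ^ k / f x)) (INR (S k) * m k).
Proof.
  assert (CM := cont0_moment k). assert (CN := cont0_N).
  assert (CNM : cont0 (fun x => N x * (x ^ k / f x))) by now apply cont0_mult.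
  unfold int_to.
  apply (is_lim_ext_loc
           (fun B => INR (S k) * RInt (fun x => x ^ k / f x) 0 B - B ^ S k / f B)).
  - exists 0. intros B HB.
    assert (C1 : cont0 (fun x => INR (S k) * (x ^ k / f x))).
    { apply cont0_mult; [apply cont0_const | auto]. }
    assert (C2 : cont0 (fun x => -1 * (N x * (x ^ k / f x)))).
    { apply cont0_mult; [apply cont0_const | auto]. }
    assert (E1 : RInt (fun x => INR (S k) * (x ^ k / f x) + -1 * (N x * (x ^ k / f x))) 0 B
                 = B ^ S k / f B - 0 ^ S k / f 0).
    { apply (RInt_primitive (fun x => x ^ S k / f x)).
      - rewrite Rmin_left, Rmax_right by lra. intros x Hx.
        assert (Hf := f_pos x ltac:(lra)). auto_derive.
        + repeat split; [now apply ex_derive_entire | lra].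
        + rewrite Derive_entire, PSeries_euler by auto.
          change (match k with 0%nat => 1 | S _ => INR k + 1 end) with (INR (S k)).
          field. lra.
      - rewrite Rmin_left, Rmax_right by lra. intros x Hx.
        apply (cont0_plus _ _ C1 C2). lra. }
    cbv beta in E1, C1, C2. rewrite (RInt_plus0 _ _ 0 B C1 C2) in E1 by lra.
    rewrite (RInt_scal0 (fun x => x ^ k / f x)) in E1 by (auto; lra).
    rewrite (RInt_scal0 (fun x => N x * (x ^ k / f x))) in E1 by (auto; lra).
    rewrite pow_ne_zero in E1 by lia. rewrite f_at_0, Rdiv_0_l in E1.
    lra.
  - replace (Finite (INR (S k) * m k)) with (Finite (INR (S k) * m k - 0))
      by (f_equal; ring).
    apply is_lim_minus'.
    + exact (is_lim_scal_l _ (INR (S k)) _ _ (moment k)).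
    + apply (is_lim_0_squeeze _ (/ c (S (S k)))). intros B HB.
      assert (Hf := f_pos B ltac:(lra)). assert (Hc := c_pos (S (S k))).
      assert (HB0 : 0 < B ^ S k) by (apply pow_lt; lra).
      split; [apply Rdiv_le_0_compat; lra|].
      assert (G := f_ge_term (S (S k)) B ltac:(lra)).
      apply Rle_div_l; auto.
      replace (/ c (S (S k)) / B * f B) with (/ (c (S (S k)) * B) * f B)
        by (field; lra).
      apply (Rmult_le_reg_l (c (S (S k)) * B)); [nra|].
      rewrite <- Rmult_assoc, Rinv_r, Rmult_1_l by nra.
      apply Rle_trans with (2 := G). apply Req_le. simpl. ring.
Qed.

(** A slope [kappa] slightly off 1 makes [N x - kappa * x] tend to an infinity, so that its maximum
    or minimum is attained. *)
Lemma tilted_by_parts (kappa : R) (k : nat) :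
  cont0 (fun x => (N x - kappa * x) * (x ^ k / f x)) /\
  int_to (fun x => (N x - kappa * x) * (x ^ k / f x))
    (INR (S k) * m k - kappa * m (S k)).
Proof.
  split.
  - apply cont0_mult; [|apply cont0_moment]. apply cont0_minus; [apply cont0_N|].
    apply cont0_mult; [apply cont0_const | apply cont0_id].
  - replace (INR (S k) * m k - kappa * m (S k))
      with (INR (S k) * m k + - kappa * m (S k)) by ring.
    apply (int_to_ext (fun x => N x * (x ^ k / f x) + - kappa * (x ^ S k / f x))).
    + intros x Hx. simpl. unfold Rdiv. ring.
    + apply int_to_lin; [|apply cont0_moment | apply by_parts | apply moment].
      apply cont0_mult; [apply cont0_N | apply cont0_moment].
Qed.

Lemma m_mass (k : nat) : m k = mass k / c k.
Proof.
  assert (H := coefficient_moment k). assert (P := c_pos k).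
  rewrite <- H. field. lra.
Qed.

(* The bound on [N x - kappa * x] is averaged against the density of index [k]; the
   assumption [1 <= M] absorbs the missing mass at [k = 0]. *)
Lemma coefficient_ub (kappa M : R) (k : nat) :
  1 <= M -> (forall x, 0 <= x -> N x - kappa * x <= M) ->
  INR (S k) * c (S k) - kappa * c k <= M * c (S k).
Proof.
  intros HM H. destruct (tilted_by_parts kappa k) as [C1 I1].
  assert (C2 : cont0 (fun x => M * (x ^ k / f x))).
  { apply cont0_mult; [apply cont0_const | apply cont0_moment]. }
  assert (K : INR (S k) * m k - kappa * m (S k) <= M * m k).
  { refine (int_to_le _ _ _ _ C1 C2 _ I1 (int_to_scal _ M _ (cont0_moment k) (moment k))).
    intros x Hx. apply Rmult_le_compat_r; [|now apply H].
    apply Rdiv_le_0_compat; [now apply pow_le | now apply f_pos]. }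
  assert (P := c_pos k). assert (PS := c_pos (S k)).
  rewrite moment_S, m_mass in K.
  apply (Rmult_le_compat_l (c k * c (S k))) in K; [|nra].
  replace (c k * c (S k) * (INR (S k) * (mass k / c k) - kappa * / c (S k)))
    with (INR (S k) * mass k * c (S k) - kappa * c k) in K by (field; lra).
  replace (c k * c (S k) * (M * (mass k / c k))) with (M * mass k * c (S k)) in K
    by (field; lra).
  destruct k as [|k]; cbn [mass] in K; [|lra].
  change (INR 1) with 1 in *. assert (0 <= (M - 1) * (beta * c 1%nat)) by
    (apply Rmult_le_pos; [lra | apply Rmult_le_pos; lra]). nra.
Qed.

(** The same averaging as in [coefficient_ub]; the missing mass at [k = 0] now has the favourable
    sign, so [0 <= M] is enough. *)
Lemma coefficient_lb (kappa M : R) (k : nat) :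
  0 <= M -> (forall x, 0 <= x -> - M <= N x - kappa * x) ->
  - M * c (S k) <= INR (S k) * c (S k) - kappa * c k.
Proof.
  intros HM H. destruct (tilted_by_parts kappa k) as [C1 I1].
  assert (C2 : cont0 (fun x => - M * (x ^ k / f x))).
  { apply cont0_mult; [apply cont0_const | apply cont0_moment]. }
  assert (K : - M * m k <= INR (S k) * m k - kappa * m (S k)).
  { refine (int_to_le _ _ _ _ C2 C1 _
              (int_to_scal _ (- M) _ (cont0_moment k) (moment k)) I1).
    intros x Hx. apply Rmult_le_compat_r; [|now apply H].
    apply Rdiv_le_0_compat; [now apply pow_le | now apply f_pos]. }
  assert (P := c_pos k). assert (PS := c_pos (S k)).
  rewrite moment_S, m_mass in K.
  apply (Rmult_le_compat_l (c k * c (S k))) in K; [|nra].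
  replace (c k * c (S k) * (INR (S k) * (mass k / c k) - kappa * / c (S k)))
    with (INR (S k) * mass k * c (S k) - kappa * c k) in K by (field; lra).
  replace (c k * c (S k) * (- M * (mass k / c k))) with (- M * mass k * c (S k)) in K
    by (field; lra).
  destruct k as [|k]; cbn [mass] in K; [|lra].
  change (INR 1) with 1 in *. assert (0 <= (M + 1) * (beta * c 1%nat)) by
    (apply Rmult_le_pos; [lra | apply Rmult_le_pos; lra]). nra.
Qed.

Notation f' := (PSeries (PS_derive c)).

Lemma f_decr (x : R) : f x - 1 = x * PSeries (PS_decr_1 c) x.
Proof. rewrite PSeries_decr_1, c_0 by now apply entire_ex. ring. Qed.

Lemma entire_decr_1 : entire (PS_decr_1 c).
Proof. unfold entire. now rewrite CV_radius_decr_1. Qed.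

(** The second half of a step of the chain: the bounds on the coefficients are averaged over the
    index. For [x > 0] the right side is [M * (f x - 1) / x], without the constant term of [f]. *)
Lemma series_ub (kappa M x : R) : 0 <= x ->
  (forall k, INR (S k) * c (S k) - kappa * c k <= M * c (S k)) ->
  f' x - kappa * f x <= M * PSeries (PS_decr_1 c) x.
Proof.
  intros Hx H. assert (Hd := entire_derive c c_entire). assert (Hc := entire_decr_1).
  assert (K : PSeries (fun k => PS_derive c k + - kappa * c k) x
              <= PSeries (fun k => 0 + M * PS_decr_1 c k) x).
  { apply PSeries_le; auto.
    - now apply entire_lin.
    - apply entire_lin; auto. apply entire_0.
    - intros k. specialize (H k). unfold PS_derive, PS_decr_1. lra. }
  rewrite PSeries_lin in K by auto.
  rewrite (PSeries_lin (fun _ => 0)) in K by (auto; apply entire_0).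
  rewrite PSeries_const_0 in K. lra.
Qed.

Lemma series_lb (kappa M x : R) : 0 <= x ->
  (forall k, - M * c (S k) <= INR (S k) * c (S k) - kappa * c k) ->
  - M * PSeries (PS_decr_1 c) x <= f' x - kappa * f x.
Proof.
  intros Hx H. assert (Hd := entire_derive c c_entire). assert (Hc := entire_decr_1).
  assert (K : PSeries (fun k => 0 + - M * PS_decr_1 c k) x
              <= PSeries (fun k => PS_derive c k + - kappa * c k) x).
  { apply PSeries_le; auto.
    - apply entire_lin; auto. apply entire_0.
    - now apply entire_lin.
    - intros k. specialize (H k). unfold PS_derive, PS_decr_1. lra. }
  rewrite PSeries_lin in K by (auto; apply entire_0).
  rewrite (PSeries_lin (PS_derive c)) in K by auto.
  rewrite PSeries_const_0 in K. lra.
Qed.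

Lemma cont0_tilted (kappa : R) : cont0 (fun x => N x - kappa * x).
Proof.
  apply cont0_minus; [apply cont0_N|].
  apply cont0_mult; [apply cont0_const | apply cont0_id].
Qed.

(** Otherwise, for a small [e], the function [N x - (1 + e) * x] has a maximum [M > 1], attained at
    some [X]. Averaging twice returns a bound at [X] that is strictly smaller than [M]. *)
Lemma N_le_max_principle (x0 : R) : 0 <= x0 -> N x0 <= x0 + 1.
Proof.
  intros Hx0. apply Rnot_lt_le. intros Hlt.
  set (e := Rmin (/ 2) ((N x0 - x0 - 1) / (2 * (x0 + 1)))).
  assert (He : 0 < e).
  { apply Rmin_pos; [lra|]. apply Rdiv_lt_0_compat; lra. }
  assert (He1 : e <= / 2) by apply Rmin_l.
  assert (He2 : e * (2 * (x0 + 1)) <= N x0 - x0 - 1).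
  { apply Rle_div_r; [lra|]. apply Rmin_r. }
  assert (Hg0 : 1 < N x0 - (1 + e) * x0) by nra.
  (* With [(1 + e / 16) ^ 3 <= 1 + e / 2] the tilted function is at most [C - e * x / 2], hence
     nonpositive beyond [2 * C / e]. *)
  destruct (N_asymptotic (e / 16) ltac:(lra)) as [C HC].
  set (B := Rmax (Rmax 1 x0) (2 * C / e)).
  assert (M1 := Rmax_l (Rmax 1 x0) (2 * C / e)).
  assert (M2 := Rmax_r (Rmax 1 x0) (2 * C / e)).
  assert (M3 := Rmax_l 1 x0). assert (M4 := Rmax_r 1 x0). fold B in M1, M2.
  destruct (continuity_ab_maj (fun x => N x - (1 + e) * x) 0 B) as [X [HX1 HX2]];
    [lra| |].
  { intros x Hx. apply (cont0_continuity_pt (fun x => N x - (1 + e) * x)); [|lra].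
    apply cont0_tilted. }
  set (M := N X - (1 + e) * X) in *.
  assert (HM : 1 < M) by (specialize (HX1 x0 ltac:(lra)); lra).
  assert (Hsup : forall x, 0 <= x -> N x - (1 + e) * x <= M).
  { intros x Hx. destruct (Rle_or_lt x B) as [Hxb|Hxb]; [apply HX1; lra|].
    destruct (HC x ltac:(lra)) as [_ HU].
    assert (P3 : (1 + e / 16) ^ 3 <= 1 + e / 2).
    { assert (0 <= e * e) by nra. simpl. nra. }
    assert (HCx : 2 * C <= e * x).
    { apply Rle_trans with (e * (2 * C / e)); [apply Req_le; field; lra|].
      apply Rmult_le_compat_l; lra. }
    nra. }
  (* Multiplied by [X], this reads [M * f X <= M * (f X - 1)]: the missing constant term gives the
     contradiction. *)
  assert (K := series_ub (1 + e) M X ltac:(lra)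
                 (fun k => coefficient_ub (1 + e) M k ltac:(lra) Hsup)).
  apply (Rmult_le_compat_l X) in K; [|lra].
  replace (X * (M * PSeries (PS_decr_1 c) X)) with (M * (f X - 1)) in K
    by (rewrite f_decr; ring).
  replace (X * (f' X - (1 + e) * f X)) with (M * f X) in K; [lra|].
  unfold M. rewrite PSeries_euler. field. apply f_neq_0. lra.
Qed.

(** The mirror argument at the minimum of [N x - (1 - e) * x], whose value is [- M] with [M > 0]. *)
Lemma N_ge_max_principle (x0 : R) : 0 <= x0 -> x0 <= N x0.
Proof.
  intros Hx0. apply Rnot_lt_le. intros Hlt.
  set (e := Rmin (/ 2) ((x0 - N x0) / (2 * (x0 + 1)))).
  assert (He : 0 < e).
  { apply Rmin_pos; [lra|]. apply Rdiv_lt_0_compat; lra. }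
  assert (He1 : e <= / 2) by apply Rmin_l.
  assert (He2 : e * (2 * (x0 + 1)) <= x0 - N x0).
  { apply Rle_div_r; [lra|]. apply Rmin_r. }
  assert (Hg0 : N x0 - (1 - e) * x0 < 0) by nra.
  destruct (N_asymptotic (e / 16) ltac:(lra)) as [C HC].
  set (B := Rmax (Rmax 1 x0) (2 * C / e)).
  assert (M1 := Rmax_l (Rmax 1 x0) (2 * C / e)).
  assert (M2 := Rmax_r (Rmax 1 x0) (2 * C / e)).
  assert (M3 := Rmax_l 1 x0). assert (M4 := Rmax_r 1 x0). fold B in M1, M2.
  destruct (continuity_ab_min (fun x => N x - (1 - e) * x) 0 B) as [X [HX1 HX2]];
    [lra| |].
  { intros x Hx. apply (cont0_continuity_pt (fun x => N x - (1 - e) * x)); [|lra].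
    apply cont0_tilted. }
  set (M := - (N X - (1 - e) * X)).
  assert (HM : 0 < M) by (specialize (HX1 x0 ltac:(lra)); unfold M; lra).
  assert (Hinf : forall x, 0 <= x -> - M <= N x - (1 - e) * x).
  { intros x Hx. destruct (Rle_or_lt x B) as [Hxb|Hxb].
    { specialize (HX1 x ltac:(lra)). unfold M. lra. }
    destruct (HC x ltac:(lra)) as [HL _].
    assert (P3 : 1 - e / 2 <= (1 - e / 16) ^ 3).
    { assert (0 <= e * e) by nra. simpl. nra. }
    assert (HCx : 2 * C <= e * x).
    { apply Rle_trans with (e * (2 * C / e)); [apply Req_le; field; lra|].
      apply Rmult_le_compat_l; lra. }
    nra. }
  assert (K := series_lb (1 - e) M X ltac:(lra)
                 (fun k => coefficient_lb (1 - e) M k ltac:(lra) Hinf)).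
  apply (Rmult_le_compat_l X) in K; [|lra].
  replace (X * (- M * PSeries (PS_decr_1 c) X)) with (- M * (f X - 1)) in K
    by (rewrite f_decr; ring).
  replace (X * (f' X - (1 - e) * f X)) with (- M * f X) in K; [lra|].
  unfold M. rewrite PSeries_euler. field. apply f_neq_0. lra.
Qed.

(** * Logarithmic growth of [ln f x - x] *)

Definition h (x : R) : R := ln (f x) - x.

Lemma h_0 : h 0 = 0.
Proof. unfold h. rewrite f_at_0, ln_1. ring. Qed.

Lemma is_derive_h (x : R) : 0 <= x -> is_derive h x (f' x / f x - 1).
Proof.
  intros Hx. assert (Hf := f_pos x Hx). unfold h. auto_derive.
  - split; auto. now apply ex_derive_entire.
  - rewrite Derive_entire by auto. field. lra.
Qed.

(** [f <= f'] follows from the coefficient bounds with [kappa = 1] and [M = 0]. Going through the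
    coefficients also covers the point 0, where [x <= N x] says nothing about [f']. *)
Lemma h_incr (x y : R) : 0 <= x <= y -> h x <= h y.
Proof.
  intros H. apply (derive_nonneg_incr h (fun x => f' x / f x - 1)); [lra| |].
  - intros z Hz. apply is_derive_h. lra.
  - intros z Hz. assert (Hf := f_pos z ltac:(lra)).
    assert (K := series_lb 1 0 z ltac:(lra)).
    assert (f z <= f' z).
    { assert (K' : - 0 * PSeries (PS_decr_1 c) z <= f' z - 1 * f z); [|lra].
      apply K. intros k. apply coefficient_lb; [lra|]. intros u Hu.
      assert (L := N_ge_max_principle u Hu). lra. }
    assert (1 <= f' z / f z) by (apply Rle_div_r; lra). lra.
Qed.

(** The derivative of [ln x - h x] is [(x + 1 - N x) / x], nonnegative by the maximum principle. *)
Lemma h_ln (x y : R) : 0 < x <= y -> h y - h x <= ln y - ln x.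
Proof.
  intros H.
  assert (K : ln x - h x <= ln y - h y); [|lra].
  apply (derive_nonneg_incr (fun x => ln x - h x) (fun x => / x - (f' x / f x - 1)));
    [lra| |].
  - intros z Hz.
    apply (is_derive_minus (K := R_AbsRing) (V := R_NormedModule) ln h).
    + apply is_derive_ln. lra.
    + apply is_derive_h. lra.
  - intros z Hz. assert (Hf := f_neq_0 z ltac:(lra)).
    assert (L := N_le_max_principle z ltac:(lra)). cbv beta in L.
    rewrite PSeries_euler in L.
    replace (/ z - (f' z / f z - 1)) with ((z + 1 - z * f' z / f z) / z)
      by (field; lra).
    apply Rdiv_le_0_compat; lra.
Qed.

Lemma h_nonneg (x : R) : 0 <= x -> 0 <= h x.
Proof. intros Hx. rewrite <- h_0. apply h_incr. lra. Qed.

Lemma cont0_h (t : R) : 0 <= t -> cont0 (fun u => h (t * u)).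
Proof.
  intros Ht. apply cont0_ex_derive. intros u Hu.
  assert (Hd : ex_derive h (t * u)).
  { eexists. apply is_derive_h. now apply Rmult_le_pos. }
  auto_derive. auto.
Qed.

Lemma cont0_exp_h (t : R) : 0 <= t -> cont0 (fun u => exp (-1 * u) * h (t * u)).
Proof. intros Ht. apply cont0_mult; [apply cont0_exp | now apply cont0_h]. Qed.

(** * Exponential averages of [h] *)

Lemma h_dilation_ub (t u : R) : 0 <= t -> 0 <= u -> h (t * u) <= h t + u.
Proof.
  intros [Ht|<-] Hu.
  - destruct (Rle_or_lt u 1) as [H|H].
    + assert (h (t * u) <= h t) by (apply h_incr; nra). lra.
    + assert (K := h_ln t (t * u) ltac:(nra)). rewrite ln_mult in K by lra.
      assert (L := ln_le_sub u ltac:(lra)). lra.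
  - rewrite Rmult_0_l, h_0. lra.
Qed.

Lemma RInt_exp_h_ub (t B : R) : 0 <= t -> 0 <= B ->
  RInt (fun u => exp (-1 * u) * h (t * u)) 0 B <= h t + 1.
Proof.
  intros Ht HB.
  assert (C1 : cont0 (fun u => exp (-1 * u) * (h t + u))).
  { apply cont0_mult; [apply cont0_exp|].
    apply cont0_plus; [apply cont0_const | apply cont0_id]. }
  apply Rle_trans with (RInt (fun u => exp (-1 * u) * (h t + u)) 0 B).
  - apply RInt_le0; auto; [now apply cont0_exp_h | lra |]. intros u Hu.
    apply Rmult_le_compat_l; [apply Rlt_le, exp_pos|]. apply h_dilation_ub; lra.
  - rewrite (RInt_primitive (fun u => - (exp (-1 * u) * (h t + u + 1)))).
    + rewrite Rmult_0_r, exp_0. assert (P := exp_pos (-1 * B)).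
      assert (Hh := h_nonneg t Ht). nra.
    + intros u _. auto_derive; auto. ring.
    + rewrite Rmin_left by lra. intros u [Hu _]. now apply C1.
Qed.

(** The mean of [h] at scale [t] under the exponential law; it stays within 1 of [h t]. *)
Definition ell (t : R) : R :=
  real (Lim (fun B => RInt (fun u => exp (-1 * u) * h (t * u)) 0 B) p_infty).

Lemma ell_correct (t : R) :
  0 <= t -> int_to (fun u => exp (-1 * u) * h (t * u)) (ell t).
Proof.
  intros Ht.
  destruct (int_to_bounded (fun u => exp (-1 * u) * h (t * u)) (h t + 1)) as [l Hl].
  - now apply cont0_exp_h.
  - intros u Hu. apply Rmult_le_pos; [apply Rlt_le, exp_pos|].
    apply h_nonneg. now apply Rmult_le_pos.
  - intros B HB. now apply RInt_exp_h_ub.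
  - unfold ell. now rewrite (is_lim_unique _ _ _ Hl).
Qed.

Lemma ell_ub (t : R) : 0 <= t -> ell t <= h t + 1.
Proof.
  intros Ht. apply (is_lim_R_ub _ 0 _ _) with (2 := ell_correct t Ht).
  intros B HB. apply RInt_exp_h_ub; lra.
Qed.

(** The derivative of [u * h (t * u)] in [u] is [h (t * u) + (N (t * u) - t * u)], and the second
    term is at most 1. *)
Lemma RInt_h_lb (t : R) : 0 <= t -> h t - 1 <= RInt (fun u => h (t * u)) 0 1.
Proof.
  intros Ht. assert (Ch := cont0_h t Ht).
  assert (CN : cont0 (fun u => f1 (t * u) / f (t * u) - t * u)).
  { apply cont0_minus.
    - apply cont0_div; [apply cont0_entire, euler_entire | now apply cont0_entire |].
      intros u Hu. apply f_pos. now apply Rmult_le_pos.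
    - apply cont0_mult; [apply cont0_const | apply cont0_id]. }
  assert (E1 : RInt (fun u => h (t * u) + (f1 (t * u) / f (t * u) - t * u)) 0 1
               = 1 * h (t * 1) - 0 * h (t * 0)).
  { apply (RInt_primitive (fun u => u * h (t * u))).
    - rewrite Rmin_left by lra. intros u [Hu _].
      assert (Htu : 0 <= t * u) by now apply Rmult_le_pos.
      assert (Hd := is_derive_h (t * u) Htu).
      assert (ED : Derive (fun x => h x) (t * u) = f' (t * u) / f (t * u) - 1)
        by now apply is_derive_unique.
      auto_derive.
      + eexists. exact Hd.
      + rewrite ED, PSeries_euler. field. now apply f_neq_0.
    - rewrite Rmin_left by lra. intros u [Hu _]. now apply (cont0_plus _ _ Ch CN). }
  rewrite (RInt_plus0 _ _ 0 1 Ch CN), Rmult_1_r in E1 by lra.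
  assert (K : RInt (fun u => f1 (t * u) / f (t * u) - t * u) 0 1 <= RInt (fun _ => 1) 0 1).
  { apply RInt_le0; auto; [apply cont0_const | lra |]. intros u Hu.
    assert (L := N_le_max_principle (t * u) ltac:(apply Rmult_le_pos; lra)).
    cbv beta in L. lra. }
  rewrite RInt_const_R in K. lra.
Qed.

(** Beyond [u = 1] the difference [h (t * u) - h t] is nonnegative. On [0, 1] it is nonpositive, so
    replacing the weight [exp (- u)] by 1 lowers the integral, and [RInt_h_lb] applies. *)
Lemma ell_lb (t : R) : 0 <= t -> h t - 1 <= ell t.
Proof.
  intros Ht. assert (Ch := cont0_h t Ht).
  set (g := fun u => exp (-1 * u) * h (t * u) + - h t * exp (-1 * u)).
  assert (Cg : cont0 g).
  { apply cont0_plus; [now apply cont0_exp_h|].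
    apply cont0_mult; [apply cont0_const | apply cont0_exp]. }
  assert (Ig : int_to g (ell t + - h t * 1)).
  { apply int_to_lin; [now apply cont0_exp_h | apply cont0_exp
                      | now apply ell_correct | apply int_to_exp]. }
  assert (K : -1 <= ell t + - h t * 1); [|lra].
  apply (is_lim_R_lb _ 1 _ _) with (2 := Ig). intros B HB.
  rewrite <- (RInt_Chasles0 g 0 1 B) by (auto; lra).
  assert (0 <= RInt g 1 B).
  { apply RInt_ge00; auto; [lra|]. intros u Hu. unfold g.
    assert (h t <= h (t * u)) by (apply h_incr; nra).
    assert (P := exp_pos (-1 * u)). nra. }
  assert (Cd : cont0 (fun u => h (t * u) + - h t)).
  { apply cont0_plus; auto. apply cont0_const. }
  assert (K1 : RInt (fun u => h (t * u) + - h t) 0 1 <= RInt g 0 1).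
  { apply RInt_le0; auto; [lra|]. intros u Hu. unfold g.
    assert (h (t * u) <= h t) by (apply h_incr; nra).
    assert (P := exp_pos (-1 * u)).
    assert (exp (-1 * u) <= 1) by (rewrite <- exp_0; apply Rlt_le, exp_increasing; lra).
    nra. }
  rewrite (RInt_plus0 (fun u => h (t * u)) (fun _ => - h t)), RInt_const_R in K1
    by (auto; try apply cont0_const; lra).
  assert (K2 := RInt_h_lb t Ht). lra.
Qed.

Lemma f_exp_h (x : R) : 0 <= x -> f x = exp (h x + x).
Proof.
  intros Hx. unfold h. replace (ln (f x) - x + x) with (ln (f x)) by ring.
  symmetry. apply exp_ln. now apply f_pos.
Qed.

(** With [s = 1 - 1 / t] the right side of the equation is [t - beta]; the substitution [x = t * u]
    divides it by [t]. *)
Lemma rescaled_balance (t : R) : 1 <= t ->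
  int_to (fun u => exp (-1 * u) * exp (- (h (t * u) - h ((t - 1) * u)))) (1 - beta / t).
Proof.
  intros Ht. set (s := (t - 1) / t).
  assert (Hs : 0 <= s < 1).
  { unfold s. split; [apply Rdiv_le_0_compat; lra | apply Rlt_div_l; lra]. }
  assert (I1 := balanced_int_to s Hs).
  replace (1 / (1 - s) - beta) with (t - beta) in I1 by (unfold s; field; lra).
  set (g := fun x => f (s * x) / f x) in I1. assert (Cg : cont0 g) by apply cont0_Phi.
  apply (is_lim_dilation _ t) in I1; auto.
  apply (is_lim_scal_l _ (/ t)) in I1.
  replace (Rbar_mult (/ t) (t - beta)) with (Finite (1 - beta / t)) in I1
    by (simpl; f_equal; field; lra).
  apply is_lim_ext_loc with (2 := I1). exists 0. intros B HB.
  assert (E1 : RInt (fun y => t * g (t * y + 0)) 0 B = RInt g (t * 0 + 0) (t * B + 0)).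
  { apply (RInt_comp_lin (V := R_CompleteNormedModule)).
    apply cont0_ex_RInt; auto; nra. }
  rewrite Rmult_0_r, !Rplus_0_r in E1. rewrite <- E1.
  assert (Cgt : cont0 (fun y => g (t * y + 0))).
  { unfold g. apply cont0_div.
    - apply cont0_ex_derive. intros u _. auto_derive. now apply ex_derive_entire.
    - apply cont0_ex_derive. intros u _. auto_derive. now apply ex_derive_entire.
    - intros u Hu. apply f_pos. nra. }
  rewrite (RInt_scal0 (fun y => g (t * y + 0))) by (auto; lra).
  rewrite <- Rmult_assoc, Rinv_l, Rmult_1_l by lra.
  apply RInt_ext. rewrite Rmin_left, Rmax_right by lra. intros u Hu. unfold g.
  rewrite Rplus_0_r. replace (s * (t * u)) with ((t - 1) * u) by (unfold s; field; lra).
  rewrite (f_exp_h (t * u)), (f_exp_h ((t - 1) * u)) by (apply Rmult_le_pos; lra).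
  unfold Rdiv. rewrite <- exp_Ropp, <- !exp_plus. f_equal. ring.
Qed.

(** The increment [y u] of [h] lies between 0 and [1 / (t - 1)] by [h_incr] and [h_ln]. Integrating
    [1 - y <= exp (- y) <= 1 - y + y ^ 2 / 2] against [exp (- u)] turns [rescaled_balance] into the
    two bounds. *)
Lemma ell_step (t : R) : 2 <= t ->
  beta / t <= ell t - ell (t - 1) <= beta / t + / ((t - 1) * (t - 1)) / 2.
Proof.
  intros Ht. set (l := / (t - 1)).
  assert (Hl : 0 < l) by (apply Rinv_0_lt_compat; lra).
  set (y := fun u => h (t * u) - h ((t - 1) * u)).
  assert (Hy : forall u, 0 <= u -> 0 <= y u <= l).
  { intros u [Hu|<-].
    - unfold y. split.
      + assert (h ((t - 1) * u) <= h (t * u)) by (apply h_incr; nra). lra.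
      + assert (K := h_ln ((t - 1) * u) (t * u) ltac:(nra)).
        rewrite !ln_mult in K by lra.
        assert (L := ln_le_sub (t / (t - 1)) ltac:(apply Rdiv_lt_0_compat; lra)).
        rewrite ln_div in L by lra.
        replace (t / (t - 1) - 1) with l in L by (unfold l; field; lra). lra.
    - unfold y. rewrite !Rmult_0_r. lra. }
  assert (Ct := cont0_exp_h t ltac:(lra)).
  assert (Ct1 := cont0_exp_h (t - 1) ltac:(lra)). assert (Ce := cont0_exp (-1)).
  assert (Iy := int_to_lin _ _ (-1) _ _ Ct Ct1 (ell_correct t ltac:(lra))
                  (ell_correct (t - 1) ltac:(lra))).
  assert (Cy : cont0 (fun u => exp (-1 * u) * h (t * u)
                               + -1 * (exp (-1 * u) * h ((t - 1) * u)))).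
  { apply cont0_plus; auto. apply cont0_mult; auto. apply cont0_const. }
  assert (Ib := rescaled_balance t ltac:(lra)).
  assert (Cb : cont0 (fun u => exp (-1 * u) * exp (- (h (t * u) - h ((t - 1) * u))))).
  { apply cont0_mult; auto. apply cont0_ex_derive. intros u Hu.
    assert (D1 : ex_derive h (t * u)).
    { eexists. apply is_derive_h. apply Rmult_le_pos; lra. }
    assert (D2 : ex_derive h ((t - 1) * u)).
    { eexists. apply is_derive_h. apply Rmult_le_pos; lra. }
    auto_derive. auto. }
  split.
  - assert (I1 := int_to_lin _ _ (-1) _ _ Ce Cy int_to_exp Iy).
    cut (1 + -1 * (ell t + -1 * ell (t - 1)) <= 1 - beta / t); [lra|].
    refine (int_to_le _ _ _ _ (cont0_plus _ _ Ce (cont0_mult _ _ (cont0_const (-1)) Cy))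
              Cb _ I1 Ib).
    intros u Hu. assert (P := exp_pos (-1 * u)). fold (y u).
    assert (L := exp_ineq1_le (- y u)).
    replace (exp (-1 * u) + -1 * (exp (-1 * u) * h (t * u)
               + -1 * (exp (-1 * u) * h ((t - 1) * u))))
      with (exp (-1 * u) * (1 + - y u)) by (unfold y; ring).
    apply Rmult_le_compat_l; lra.
  - assert (I1 := int_to_lin _ _ (-1) _ _
                    (cont0_mult _ _ (cont0_const (1 + l * l / 2)) Ce) Cy
                    (int_to_scal _ (1 + l * l / 2) _ Ce int_to_exp) Iy).
    cut (1 - beta / t <= (1 + l * l / 2) * 1 + -1 * (ell t + -1 * ell (t - 1))).
    { intros K. replace (/ ((t - 1) * (t - 1)) / 2) with (l * l / 2)
        by (unfold l; field; lra). lra. }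
    refine (int_to_le _ _ _ _ Cb _ _ Ib I1).
    + apply cont0_plus; [apply cont0_mult | apply cont0_mult]; auto; apply cont0_const.
    + intros u Hu. assert (P := exp_pos (-1 * u)). fold (y u).
      assert (Hyu := Hy u Hu). assert (L := exp_neg_le (y u) (proj1 Hyu)).
      replace ((1 + l * l / 2) * exp (-1 * u) + -1 * (exp (-1 * u) * h (t * u)
                 + -1 * (exp (-1 * u) * h ((t - 1) * u))))
        with (exp (-1 * u) * (1 + l * l / 2 - y u)) by (unfold y; ring).
      apply Rmult_le_compat_l; nra.
Qed.

Lemma ell_asymptotic (n : nat) :
  Rabs (ell (INR (S n)) - beta * ln (INR (S n)) - ell 1) <= 1 - / INR (S n).
Proof.
  induction n as [|n IH].
  - change (INR 1) with 1. rewrite ln_1, Rinv_1.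
    replace (ell 1 - beta * 0 - ell 1) with 0 by ring. rewrite Rabs_R0. lra.
  - set (t := INR (S n)) in *.
    assert (Ht : 1 <= t) by (unfold t; rewrite S_INR; assert (K := pos_INR n); lra).
    rewrite S_INR. fold t.
    destruct (ell_step (t + 1) ltac:(lra)) as [L1 L2].
    replace (t + 1 - 1) with t in L1, L2 by ring.
    (* Each step changes [ell t - beta * ln t] by at most [/ t - / (t + 1)], so the errors
       telescope. *)
    assert (D : / t - / (t + 1) = / (t * (t + 1))) by (field; lra).
    assert (D2 : / (t * t) / 2 <= / (t * (t + 1))).
    { replace (/ (t * t) / 2) with (/ (t * t * 2)) by (field; lra).
      apply Rinv_le_contravar; nra. }
    assert (U := ln_le_sub ((t + 1) / t) ltac:(apply Rdiv_lt_0_compat; lra)).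
    assert (V := ln_le_sub (t / (t + 1)) ltac:(apply Rdiv_lt_0_compat; lra)).
    rewrite ln_div in U, V by lra.
    replace ((t + 1) / t - 1) with (/ t) in U by (field; lra).
    replace (t / (t + 1) - 1) with (- / (t + 1)) in V by (field; lra).
    apply Rabs_le_between in IH.
    assert (B1 : beta * / (t + 1) <= beta * (ln (t + 1) - ln t))
      by (apply Rmult_le_compat_l; lra).
    assert (B2 : beta * (ln (t + 1) - ln t) <= beta * / t)
      by (apply Rmult_le_compat_l; lra).
    assert (B3 : beta * (/ t - / (t + 1)) <= / t - / (t + 1)).
    { assert (0 < / (t * (t + 1))) by (apply Rinv_0_lt_compat; nra). rewrite D. nra. }
    unfold Rdiv in L1, L2 at 1. apply Rabs_le. lra.
Qed.

(** Let [t] be the integer part of [x]. Since [x / t <= 2], both [h] and [beta * ln] vary by at most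
    1 from [t] to [x]; [h t] is within 1 of [ell t], and [ell_asymptotic] costs 1 more. *)
Lemma h_asymptotic : exists K, forall x, 1 <= x -> Rabs (h x - beta * ln x) <= K.
Proof.
  exists (Rabs (ell 1) + 4). intros x Hx.
  destruct (nfloor_ex x ltac:(lra)) as [n [Hn1 Hn2]].
  destruct n as [|n]; [simpl in Hn2; lra|].
  assert (A := ell_asymptotic n). set (t := INR (S n)) in *.
  assert (Ht : 1 <= t) by (unfold t; rewrite S_INR; assert (K := pos_INR n); lra).
  assert (Hi : 0 < / t) by (apply Rinv_0_lt_compat; lra).
  assert (L1 := ell_lb t ltac:(lra)). assert (L2 := ell_ub t ltac:(lra)).
  assert (H1 := h_incr t x ltac:(lra)). assert (H2 := h_ln t x ltac:(lra)).
  assert (U := ln_le_sub (x / t) ltac:(apply Rdiv_lt_0_compat; lra)).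
  rewrite ln_div in U by lra.
  assert (x / t <= 2) by (apply Rle_div_l; lra).
  assert (V : ln t <= ln x) by (apply ln_le; lra).
  assert (B : 0 <= beta * (ln x - ln t) <= 1) by nra.
  assert (E1 := Rabs_le_between (ell 1) (Rabs (ell 1))).
  destruct (proj1 E1 (Rle_refl _)) as [E2 E3].
  apply Rabs_le_between in A. apply Rabs_le. lra.
Qed.

Lemma h_over_ln : is_lim (fun x => h x / ln x) p_infty beta.
Proof.
  destruct h_asymptotic as [K HK].
  assert (K0 : 0 <= K) by (apply Rle_trans with (2 := HK 1 (Rle_refl 1)); apply Rabs_pos).
  apply is_lim_spec. intros eps. assert (He := cond_pos eps).
  exists (exp (K / eps + 1)). intros x Hx.
  assert (Hq : 0 <= K / eps) by (apply Rdiv_le_0_compat; lra).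
  assert (Hx1 : 1 < x).
  { assert (L := exp_ineq1_le (K / eps + 1)). lra. }
  assert (Hln : K / eps + 1 < ln x).
  { rewrite <- (ln_exp (K / eps + 1)). apply ln_increasing; auto. apply exp_pos. }
  replace (h x / ln x - beta) with ((h x - beta * ln x) / ln x) by (field; lra).
  unfold Rdiv. rewrite Rabs_mult, (Rabs_pos_eq (/ ln x))
    by (apply Rlt_le, Rinv_0_lt_compat; lra).
  apply (Rmult_lt_reg_r (ln x)); [lra|].
  rewrite Rmult_assoc, Rinv_l, Rmult_1_r by lra.
  apply Rle_lt_trans with (1 := HK x ltac:(lra)).
  assert (K / eps < ln x) by lra. apply Rlt_div_l in H; lra.
Qed.

End Balanced.

Theorem theorem1p2 (beta : R) (c : nat -> R) :
  0 <= beta < 1 ->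
  (forall x : R, 0 <= x -> ex_pseries c x) ->
  series_fun c 0 = 1 ->
  balanced_eq beta (series_fun c) ->
  exists omega : R,
    is_lim (fun x => (ln (series_fun c x) - x) / ln x) p_infty (Finite omega).
Proof.
  intros Hbeta Hc H0 Hbal. exists beta.
  exact (h_over_ln beta c Hbeta (entire_intro c Hc) H0 Hbal).
Qed.
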